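(* Let $k$ be a positive integer with $k\equiv 2\pmod 4$ such that every odd prime factor of $k$ is congruent to $3\pmod 4$. Then the integer solutions $(x,y,n)$ of the Diophantine equation $$x^k+(x+1)^k=y^n,\qquad n\ge 3,$$ are, up to the sign of $y$ when $n$ is even, exactly the following: $(x,y)=(0,1)$ and $(x,y)=(-1,1)$ for every $n\ge 3$, together with, when $k=2$, $(x,y,n)=(119,13,4)$ and $(x,y,n)=(-120,13,4)$.
   Context: The unknowns $x,y,n$ are rational integers. The case that $k$ has no odd prime factor (i.e. $k=2$) is included. *)

(* Defs.v *)
From mathcomp Require Import all_boot all_order all_algebra.
Set Implicit Arguments.
Unset Strict Implicit.
Unset Printing Implicit Defensive.

(* Main.v *)
(** Write k = 2m with m odd. The number s = x^2 + (x+1)^2 divides x^k + (x+1)^k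
    with a cofactor congruent to m x^(2(m-1)) modulo s. A common prime divisor of
    both would divide m, hence be 3 mod 4, but it also divides a sum of two coprime
    squares. So s is itself an n-th power, and the case k = 2 decides.

    If n has an odd factor at least 3 (Stormer), then (x+1) + i x is an n-th power
    g^n in Z[i]. The real part 1 of (1+i) g^n is divisible by the sum or the
    difference of the coordinates of g, which is thus 1 or -1, and a comparison of
    2-adic valuations in the binomial expansion leaves only the trivial solutions.

    If 4 divides n (Ljunggren), then (2x+1)^2 + 1 = 2 Y^4. This is solved by Thue's
    method, based on the solution 239^2 + 1 = 2 * 13^4. Let u^4 = 239 + i. The Pade
    approximants of t^(1/4) at t = (239+i)/(239-i) give Gaussian integers N_r with
    components at most 7700^r such that u N_r is almost real: |Im (u N_r)| <= (8/239)^r.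
    Another solution provides a Gaussian integer w with u w almost real, and then
    Im (N_r conj(w)) is an integer of absolute value < 1 for two consecutive r,
    which contradicts the independence of N_r and N_(r+1). This bounds Y, and the
    finitely many remaining Pell numbers are sieved modulo small primes. *)
From HB Require Import structures.
Require Import Defs.
From mathcomp Require Import all_boot all_order all_algebra all_field.
From mathcomp Require Import polyrcf complex realalg.
From mathcomp Require Import zify ring lra.
Set Implicit Arguments.
Unset Strict Implicit.
Unset Printing Implicit Defensive.
Import Order.TTheory GRing.Theory Num.Theory.
Local Open Scope ring_scope.

(** * Gaussian integers *)

Record gint := Gint { gre : int; gim : int }.
Implicit Types z w t : gint.

Definition gint_pair (z : gint) := (gre z, gim z).
Definition pair_gint (u : int * int) := Gint u.1 u.2.
Lemma gint_pairK : cancel gint_pair pair_gint. Proof. by case. Qed.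

HB.instance Definition _ := Equality.copy gint (can_type gint_pairK).
HB.instance Definition _ := Choice.copy gint (can_type gint_pairK).

Lemma gintP z w : gre z = gre w -> gim z = gim w -> z = w.
Proof. by case: z w => [a b] [c d] /= -> ->. Qed.

Definition gadd z w := Gint (gre z + gre w) (gim z + gim w).
Definition gopp z := Gint (- gre z) (- gim z).
Definition gmul z w :=
  Gint (gre z * gre w - gim z * gim w) (gre z * gim w + gim z * gre w).

Lemma gaddA : associative gadd.
Proof. by move=> x y z; apply: gintP; rewrite /= addrA. Qed.
Lemma gaddC : commutative gadd.
Proof. by move=> x y; apply: gintP; rewrite /= addrC. Qed.
Lemma gadd0 : left_id (Gint 0 0) gadd.
Proof. by move=> x; apply: gintP; rewrite /= add0r. Qed.
Lemma gaddN : left_inverse (Gint 0 0) gopp gadd.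
Proof. by move=> x; apply: gintP; rewrite /= addNr. Qed.
HB.instance Definition _ := GRing.isZmodule.Build gint gaddA gaddC gadd0 gaddN.

Lemma gmulA : associative gmul.
Proof. by move=> x y z; apply: gintP => /=; ring. Qed.
Lemma gmulC : commutative gmul.
Proof. by move=> x y; apply: gintP => /=; ring. Qed.
Lemma gmul1 : left_id (Gint 1 0) gmul.
Proof. by move=> x; apply: gintP => /=; ring. Qed.
Lemma gmulDl : left_distributive gmul gadd.
Proof. by move=> x y z; apply: gintP => /=; ring. Qed.
Lemma gint1_neq0 : Gint 1 0 != Gint 0 0. Proof. by []. Qed.
HB.instance Definition _ :=
  GRing.Zmodule_isComNzRing.Build gint gmulA gmulC gmul1 gmulDl gint1_neq0.

Lemma greD z w : gre (z + w) = gre z + gre w. Proof. by []. Qed.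
Lemma gimD z w : gim (z + w) = gim z + gim w. Proof. by []. Qed.
Lemma greN z : gre (- z) = - gre z. Proof. by []. Qed.
Lemma gimN z : gim (- z) = - gim z. Proof. by []. Qed.
Lemma greM z w : gre (z * w) = gre z * gre w - gim z * gim w.
Proof. by []. Qed.
Lemma gimM z w : gim (z * w) = gre z * gim w + gim z * gre w.
Proof. by []. Qed.
Lemma gre_is_additive : zmod_morphism gre. Proof. by []. Qed.
Lemma gim_is_additive : zmod_morphism gim. Proof. by []. Qed.
HB.instance Definition _ := GRing.isZmodMorphism.Build gint int gre gre_is_additive.
HB.instance Definition _ := GRing.isZmodMorphism.Build gint int gim gim_is_additive.

Definition gi := Gint 0 1.
Definition gconj z := Gint (gre z) (- gim z).
Definition gnorm z : int := gre z ^+ 2 + gim z ^+ 2.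
Definition gofint (a : int) := Gint a 0.

Lemma gconj_is_additive : zmod_morphism gconj.
Proof. by move=> x y; apply: gintP => /=; ring. Qed.
Lemma gconj_is_multiplicative : monoid_morphism gconj.
Proof. by split=> [|x y]; apply: gintP => /=; ring. Qed.
HB.instance Definition _ := GRing.isZmodMorphism.Build gint gint gconj gconj_is_additive.
HB.instance Definition _ :=
  GRing.isMonoidMorphism.Build gint gint gconj gconj_is_multiplicative.

Lemma gofint_is_additive : zmod_morphism gofint.
Proof. by move=> x y; apply: gintP => /=; ring. Qed.
Lemma gofint_is_multiplicative : monoid_morphism gofint.
Proof. by split=> [|x y]; apply: gintP => /=; ring. Qed.
HB.instance Definition _ := GRing.isZmodMorphism.Build int gint gofint gofint_is_additive.
HB.instance Definition _ :=
  GRing.isMonoidMorphism.Build int gint gofint gofint_is_multiplicative.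

Lemma gre_scale a z : gre (gofint a * z) = a * gre z.
Proof. by rewrite greM /= mul0r subr0. Qed.
Lemma gim_scale a z : gim (gofint a * z) = a * gim z.
Proof. by rewrite gimM /= mul0r addr0. Qed.

Lemma gre_natmul z n : gre (z *+ n) = n%:Z * gre z.
Proof. by rewrite raddfMn -mulr_natl natz. Qed.

Lemma gim_natmul z n : gim (z *+ n) = n%:Z * gim z.
Proof. by rewrite raddfMn -mulr_natl natz. Qed.
Lemma gre_natM n z : gre (n%:R * z) = n%:Z * gre z.
Proof. by rewrite mulr_natl gre_natmul. Qed.
Lemma gim_natM n z : gim (n%:R * z) = n%:Z * gim z.
Proof. by rewrite mulr_natl gim_natmul. Qed.

Lemma gnormM z w : gnorm (z * w) = gnorm z * gnorm w.
Proof. by rewrite /gnorm greM gimM; ring. Qed.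
Lemma gnormX z n : gnorm (z ^+ n) = gnorm z ^+ n.
Proof. by elim: n => // n IH; rewrite !exprS gnormM IH. Qed.
Lemma gnorm_ge0 z : 0 <= gnorm z. Proof. by rewrite addr_ge0 ?sqr_ge0. Qed.
Lemma gnorm_eq0 z : (gnorm z == 0) = (z == 0).
Proof.
case: z => a b; rewrite /gnorm paddr_eq0 ?sqr_ge0 // !expf_eq0 /=.
by apply/andP/eqP => [[/eqP-> /eqP->]|[-> ->]].
Qed.

Lemma gmul_eq0 z w : z * w = 0 -> z = 0 \/ w = 0.
Proof.
move/eqP; rewrite -gnorm_eq0 gnormM mulf_eq0 !gnorm_eq0.
by case/orP=> /eqP; [left|right].
Qed.
Lemma gmulI z w t : z <> 0 -> z * w = z * t -> w = t.
Proof.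
move=> z0 /eqP; rewrite -subr_eq0 -mulrBr => /eqP/gmul_eq0[//|/eqP].
by rewrite subr_eq0 => /eqP.
Qed.

Definition gdvd z w := exists t, w = z * t.

Lemma gnorm1_unit z : gnorm z = 1 -> exists j, (j < 4)%N /\ z = gi ^+ j.
Proof.
case: z => a b; rewrite /gnorm /= => h.
have : (-1 <= a <= 1) /\ (-1 <= b <= 1) by nia.
move=> [ha hb].
have : (a = -1 \/ a = 0 \/ a = 1) /\ (b = -1 \/ b = 0 \/ b = 1) by lia.
case=> [[Ea|[Ea|Ea]] [Eb|[Eb|Eb]]]; rewrite {}Ea {}Eb in h *; try by [].
- by exists 2%N.
- by exists 3%N.
- by exists 1%N.
- by exists 0%N.
Qed.

Lemma round_div (a n : int) : 0 < n -> exists q, - n <= 2 * (a - q * n) <= n.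
Proof.
move=> n0; exists ((2 * a + n) %/ (2 * n))%Z.
have := divz_eq (2 * a + n) (2 * n).
have : (0 <= (2 * a + n) %% (2 * n))%Z by rewrite modz_ge0; lia.
have : ((2 * a + n) %% (2 * n) < 2 * n)%Z by rewrite ltz_pmod; lia.
by move: (_ %/ _)%Z (_ %% _)%Z => q r; nia.
Qed.

(** Rounding both coordinates of [z * gconj w / gnorm w] to nearest integers leaves errors of at
    most 1/2 each, so the remainder has at most half the norm of [w]. *)
Lemma gint_div z w : w <> 0 -> exists q, gnorm (z - q * w) < gnorm w.
Proof.
move=> w0; have n0 : 0 < gnorm w by rewrite lt_def gnorm_ge0 gnorm_eq0 andbT; apply/eqP.
have [a ha] := round_div (gre (z * gconj w)) n0.
have [b hb] := round_div (gim (z * gconj w)) n0.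
exists (Gint a b); rewrite -(ltr_pM2r n0).
set r := _ - _.
have E : gnorm r * gnorm w = gnorm (r * gconj w).
  by rewrite gnormM; congr (_ * _); rewrite /gnorm /=; ring.
have : r * gconj w = Gint (gre (z * gconj w) - a * gnorm w) (gim (z * gconj w) - b * gnorm w).
  by apply: gintP; rewrite /r /gnorm /=; ring.
rewrite E => ->; move: ha hb n0.
move: (gnorm w) => n; set u := gre _ - _; set v := gim _ - _ => hu hv n0.
have h1 : 0 <= (n - 2 * u) * (n + 2 * u) by rewrite mulr_ge0; lia.
have h2 : 0 <= (n - 2 * v) * (n + 2 * v) by rewrite mulr_ge0; lia.
by rewrite /gnorm /=; move: h1 h2; clear -n0; move: u v => u v; nia.
Qed.

Lemma gint_bezout z w : exists d s t, [/\ gdvd d z, gdvd d w & d = s * z + t * w].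
Proof.
have [m] := ubnP (absz (gnorm w)); elim: m z w => // m IH z w hm.
have [->|/eqP w0] := eqVneq w 0.
  exists z, 1, 0; split; [by exists 1; rewrite mulr1|by exists 0; rewrite mulr0|ring].
have [q hq] := gint_div z w0.
have [|d [s [t [hd1 hd2 hd3]]]] := IH w (z - q * w).
  by have := gnorm_ge0 (z - q * w); lia.
exists d, t, (s - t * q); split => //; last by rewrite hd3; ring.
case: hd1 hd2 => a ha [b hb]; exists (b + q * a).
by rewrite mulrDr -hb mulrCA -ha; ring.
Qed.

Definition gcoprime z w := exists s t, s * z + t * w = 1.

Lemma gcoprimeC z w : gcoprime z w -> gcoprime w z.
Proof. by case=> s [t h]; exists t, s; rewrite addrC. Qed.
Lemma gcoprimeMr z w t : gcoprime z w -> gcoprime z t -> gcoprime z (w * t).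
Proof.
case=> a [b h1] [c [d h2]]; exists (a * c * z + a * d * t + b * w * c), (b * d).
by transitivity ((a * z + b * w) * (c * z + d * t)); [ring | rewrite h1 h2 mulr1].
Qed.
Lemma gcoprimeXr z w n : gcoprime z w -> gcoprime z (w ^+ n).
Proof.
move=> h; elim: n => [|n IH]; first by exists 0, 1; rewrite expr0; ring.
by rewrite exprS; apply: gcoprimeMr.
Qed.
Lemma gcoprime_dvdl z w t : gdvd t z -> gcoprime z w -> gcoprime t w.
Proof. by case=> a -> [b [c h]]; exists (b * a), c; rewrite -h; ring. Qed.
Lemma gauss_gint z w t : gcoprime z w -> gdvd z (w * t) -> gdvd z t.
Proof.
case=> a [b h] [c hc]; exists (a * t + b * c).
rewrite -[LHS]mul1r -h mulrDl -[b * w * t]mulrA hc; ring.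
Qed.

(** Let [d] be a gcd of [z] and [y], with [z = d z'] and [y = d y']. Coprimality makes [w] and
    [y' ^+ n.+1] divide each other, so they differ by a unit, and [z'] is that unit times
    [d ^+ n]. *)
Lemma gint_coprime_expn z w y n : z <> 0 -> w <> 0 -> gcoprime z w ->
  z * w = y ^+ n.+1 -> exists j d, (j < 4)%N /\ z = gi ^+ j * d ^+ n.+1.
Proof.
move=> z0 w0 hzw E.
have [d [s [t [[z' hz] [y' hy] hd]]]] := gint_bezout z y.
have d0 : d <> 0 by move=> d0; apply: z0; rewrite hz d0 mul0r.
have cop : gcoprime z' y'.
  exists s, t; apply: (gmulI d0); rewrite mulr1 [RHS]hd hz hy; ring.
have E2 : z' * w = d ^+ n * y' ^+ n.+1.
  by apply: (gmulI d0); rewrite mulrA -hz E hy exprMn (exprS d) mulrA.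
have cdw : gcoprime (d ^+ n) w.
  by apply/gcoprimeC/gcoprimeXr/gcoprimeC/(gcoprime_dvdl _ hzw); exists z'.
have [e he] : gdvd w (y' ^+ n.+1).
  by apply: (gauss_gint (gcoprimeC cdw)); rewrite -E2; exists z'; rewrite mulrC.
have [f hf] : gdvd (y' ^+ n.+1) w.
  apply: (gauss_gint (gcoprimeC (gcoprimeXr _ cop))).
  by rewrite E2; exists (d ^+ n); rewrite mulrC.
have ef : e * f = 1.
  by apply: (gmulI w0); rewrite mulr1 {2}hf he; ring.
have /gnorm1_unit[j [j4 hj]] : gnorm e = 1.
  have h : gnorm e * gnorm f = 1 by rewrite -gnormM ef.
  by move: (gnorm_ge0 e) (gnorm_ge0 f) h; case: (gnorm e) (gnorm f) => [a|a] [b|b] // _ _; rewrite -PoszM => [[/eqP]]; rewrite muln_eq1 => /andP[/eqP->].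
exists j, d; split=> //; rewrite hz exprS mulrCA; congr (_ * _).
by apply: (gmulI w0); rewrite mulrC E2 he -hj; ring.
Qed.

Lemma consecutive_squares_expn (x y : int) n : x ^+ 2 + (x + 1) ^+ 2 = y ^+ n.+1 ->
  exists j d, (j < 4)%N /\ Gint (x + 1) x = gi ^+ j * d ^+ n.+1.
Proof.
move=> E; apply: (@gint_coprime_expn _ (Gint (x + 1) (- x)) (gofint y)).
- by case; lia.
- by case; lia.
- exists (Gint (x + 1) (- x) - gofint (x ^+ 2 + x) * Gint 1 1).
  exists (- gofint (x ^+ 2 + x) * Gint 1 (-1)).
  by apply: gintP; rewrite !(greD, gimD, greM, gimM, greN, gimN) /=; ring.
- by rewrite -rmorphXn -E; apply: gintP; rewrite /=; ring.
Qed.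

(** * Odd exponents *)

(** For [t] nonzero, 2-adic valuations give v(t) = v(M) + v(w) - v(k), and v(w) >= s > v(k) because
    [k < 2 ^ s]. *)
Lemma dvdz_pow2_quot (M t w : int) (k s : nat) : M != 0 -> (0 < k < 2 ^ s)%N ->
  ((2 ^+ s)%R %| w)%Z -> k%:Z * t = M * w -> ((2 ^+ (logn 2 `|M|).+1)%R %| t)%Z.
Proof.
move=> M0 /andP[k0 ks] sw E.
have [->|t0] := eqVneq t 0; first exact: dvdz0.
have w0 : w != 0.
  by apply: contraNneq t0 => w0; move: E; rewrite w0; nia.
have := congr1 (fun a : int => logn 2 (absz a)) E; rewrite !abszM !lognM ?absz_gt0 //=; last lia.
move=> El.
have hw : (s <= logn 2 `|w|)%N.
  by rewrite -pfactor_dvdn ?absz_gt0 //; move: sw; rewrite dvdzE abszX.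
have hk : (logn 2 k < s)%N.
  by rewrite -(ltn_exp2l _ _ (ltnSn 1)); apply: leq_ltn_trans ks; apply/dvdn_leq/pfactor_dvdnn.
rewrite dvdzE abszX pfactor_dvdn ?absz_gt0 //; move: El hw hk.
by move: (logn 2 k) (logn 2 `|t|) (logn 2 `|M|) (logn 2 `|w|) => a b c d; lia.
Qed.

(** Otherwise 2 would divide [M] to a power beyond its own valuation. *)
Lemma dominant_term_eq0 (M : int) (n : nat) (F : 'I_n -> int) :
  M = \sum_j F j ->
  (M != 0 -> forall j, ((2 ^+ (logn 2 `|M|).+1)%R %| F j)%Z) -> M = 0.
Proof.
move=> EM h; apply/eqP; apply: contraT => M0.
have : ((2 ^+ (logn 2 `|M|).+1)%R %| M)%Z.
  by rewrite [X in (_ %| X)%Z]EM; apply: rpred_sum => j _; apply: h.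
by rewrite dvdzE abszX pfactor_dvdn ?absz_gt0 // ltnn.
Qed.

Local Notation gi1 := (Gint 1 1).

(** [e ^+ 2] is 2 times a unit, and so is [gi1 * e]; hence every second factor contributes a 2. *)
Lemma base_pow_dvd (e : gint) (j : nat) : e = gi1 \/ e = Gint (-1) 1 ->
  ((2 ^+ (j.+1)./2)%R %| gre (gi1 * e ^+ j))%Z.
Proof.
move=> he; suff [t ->] : gdvd (gofint (2 ^+ (j.+1)./2)) (gi1 * e ^+ j).
  by rewrite gre_scale dvdz_mulr.
have [u hu] : exists u, e ^+ 2 = gofint 2 * u.
  by case: he => ->; [exists gi | exists (- gi)]; apply: gintP.
have [v hv] : exists v, gi1 * e = gofint 2 * v.
  by case: he => ->; [exists gi | exists (-1)]; apply: gintP.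
suff: gdvd (gofint (2 ^+ (j.+1)./2)) (gi1 * e ^+ j) /\
      gdvd (gofint (2 ^+ (j.+2)./2)) (gi1 * e ^+ j.+1) by case.
elim: j => [|j [IH1 IH2]]; split=> //.
- by exists gi1; rewrite !expr0; apply: gintP.
- by exists v; rewrite !expr1.
case: IH1 => t ht; exists (t * u).
rewrite -(addn2 j) exprD hu mulrA ht.
have -> : (j + 2).+1./2 = (j.+1./2).+1 by lia.
by rewrite exprS rmorphM; ring.
Qed.

(** As [e ^+ 4 = -4], only [n] modulo 4 matters; the residues 1 and 3 give 2i and 4i up to a real
    factor. *)
Lemma base_re n : odd n -> forall e, e = (if n %% 4 == 1 then gi1 else Gint (-1) 1)%N ->
  gre (gi1 * e ^+ n) = 0.
Proof.
move=> on e ->.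
have E : (n = n %/ 4 * 4 + n %% 4)%N by rewrite -divn_eq.
have h4 : forall t, t ^+ n = (t ^+ 4) ^+ (n %/ 4) * t ^+ (n %% 4) :> gint.
  by move=> t; rewrite {1}E exprD mulnC exprM.
rewrite h4.
have -> : (if n %% 4 == 1 then gi1 else Gint (-1) 1)%N ^+ 4 = gofint (-4).
  by case: ifP => _; apply: gintP.
rewrite -rmorphXn mulrCA gre_scale.
have : (n %% 4 = 1 \/ n %% 4 = 3)%N by lia.
by case=> -> /=; rewrite mulr0.
Qed.

Lemma two_pow_bound i : ((i + 3) * (i + 2) < 2 ^ (i + 3))%N.
Proof.
elim: i => // i IH; rewrite addSn expnS; nia.
Qed.

Lemma stormer_expansion n (c : int) (e : gint) :
  gre (gi1 * (1 + gofint c * e) ^+ n) =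
  \sum_(j < n.+1) 'C(n, j)%:Z * c ^+ j * gre (gi1 * e ^+ j).
Proof.
rewrite exprDn mulr_sumr raddf_sum; apply: eq_bigr => j _.
have E : gi1 * (1 ^+ (n - j) * (gofint c * e) ^+ j *+ 'C(n, j)) =
    (gofint (c ^+ j) * (gi1 * e ^+ j)) *+ 'C(n, j).
  by rewrite expr1n mul1r exprMn -rmorphXn mulrnAr mulrCA.
by rewrite [LHS](congr1 gre E) gre_natmul gre_scale mulrA.
Qed.

(** [c ^+ m] contributes [2 ^ m], and [base_pow_dvd] a further 4 once [i >= 3]. *)
Lemma stormer_tail_dvd (c : int) (e : gint) (i s m : nat) :
  e = gi1 \/ e = Gint (-1) 1 -> (2 %| c)%Z -> (s <= m + 2)%N -> (3 <= i)%N ->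
  forall a : int, ((2 ^+ s)%R %| a * c ^+ m * gre (gi1 * e ^+ i))%Z.
Proof.
move=> he hc hs hi a; apply: dvdz_trans (dvdz_exp2l 2 hs) _.
rewrite exprD; apply: dvdz_mul; first by apply: dvdz_mull; apply: dvdz_exp2r.
by apply: dvdz_trans (base_pow_dvd i he); apply: dvdz_exp2l; lia.
Qed.

Lemma sum_ord_split3 (F : nat -> int) n m : n = m.+3 ->
  \sum_(j < n) F j = F 0%N + F 1%N + F 2%N + \sum_(i < m) F i.+3.
Proof. by move=> ->; rewrite 3!big_ord_recl !addrA. Qed.

Lemma stormer_even_eq0 n (c ep : int) (e : gint) :
  odd n -> (1 < n)%N -> (2 %| c)%Z -> ep = 1 \/ ep = -1 ->
  e = (if n %% 4 == 1 then gi1 else Gint (-1) 1)%N ->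
  gre (gi1 * (1 + gofint c * e) ^+ n) = ep -> c = 0.
Proof.
move=> on n1 hc hep He.
have he : e = gi1 \/ e = Gint (-1) 1 by rewrite He; case: ifP; [left|right].
rewrite stormer_expansion; pose r j := gre (gi1 * e ^+ j).
pose t j := 'C(n, j)%:Z * c ^+ j * r j.
have [m Em] : exists m, n = m.+2 by exists n.-2; lia.
have -> : \sum_(j < n.+1) 'C(n, j)%:Z * c ^+ j * gre (gi1 * e ^+ j) =
    t 0%N + t 1%N + t 2%N + \sum_(i < m) t i.+3 by apply: (sum_ord_split3 t); rewrite Em.
have t4 (j : nat) : (3 <= j)%N -> (4 %| t j)%Z.
  by move=> j3; apply: (@stormer_tail_dvd c e j 2 j) => //; lia.
have S4 : (4 %| \sum_(i < m) t i.+3)%Z by apply: rpred_sum => i _; apply: t4.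
have t0 : t 0%N = 1 by rewrite /t /r bin0 !expr0 mulr1.
have E1 : t 1%N = n%:Z * c * r 1%N by rewrite /t bin1 expr1.
have [d Ed] := dvdzP hc.
have hbin : (n%:Z * (n%:Z - 1) = 2 * 'C(n, 2)%:Z) by have := mul_bin_diag n 1; rewrite bin1; nia.
(* The 2-adically dominant term t j has j = 2 if n = 1 mod 4, and j = 1 if n = 3 mod 4. *)
have [n4|n4] : (n %% 4 = 1 \/ n %% 4 = 3)%N by lia.
- have r1 : r 1%N = 0 by rewrite /r He n4.
  have r2 : r 2%N = -2 by rewrite /r He n4.
  move=> E.
  (* Modulo 4 only the constant term 1 survives, since [c] is even. *)
  have ep1 : ep = 1.
    move: S4 E; rewrite t0 E1 r1 /t r2 Ed => /dvdzP[q ->]. clear -hep. nia.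
  move: E; rewrite ep1 t0 E1 r1 mulr0 addr0.
  pose M := n%:Z * (n%:Z - 1) * c ^+ 2.
  have -> : t 2%N = - M by rewrite /t r2 /M hbin; ring.
  move=> E; have : M = 0.
    apply: (@dominant_term_eq0 M m (fun i => t i.+3)).
      by apply: (addrI (1 - M)); rewrite E subrK.
    (* Absorbing twice into the binomial, [(i+3)(i+2) 'C(n, i+3) = n(n-1) 'C(n-2, i+1)], exhibits
       [M] as a factor of [(i+3)(i+2) * t i.+3]; the cofactor is divisible by [2 ^ (i+3)], which
       exceeds [(i+3)(i+2)]. *)
    move=> M0 i; apply: (@dvdz_pow2_quot M _ ('C(n - 2, i.+1)%:Z * c ^+ i.+1 * r i.+3) ((i + 3) * (i + 2)) (i + 3)) => //.
    + by rewrite two_pow_bound andbT muln_gt0 !addnS.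
    + by apply: stormer_tail_dvd => //; lia.
    rewrite -/(t i.+3); have b1 := mul_bin_diag n i.+2; have b2 := mul_bin_diag n.-1 i.+1.
    rewrite [t _]/t /M (_ : (n - 2 = n.-2)%N) //; last lia.
    have : ((i + 3) * (i + 2))%N%:Z * 'C(n, i.+3)%:Z = n%:Z * (n%:Z - 1) * 'C(n.-2, i.+1)%:Z.
      have c1 : (i + 3)%N%:Z * 'C(n, i.+3)%:Z = n%:Z * 'C(n.-1, i.+2)%:Z by lia.
      have c2 : (i + 2)%N%:Z * 'C(n.-1, i.+2)%:Z = (n%:Z - 1) * 'C(n.-2, i.+1)%:Z by lia.
      transitivity (((i + 3)%N%:Z * 'C(n, i.+3)%:Z) * (i + 2)%N%:Z); first by rewrite PoszM; ring.
      rewrite c1; transitivity (n%:Z * ((i + 2)%N%:Z * 'C(n.-1, i.+2)%:Z)); first by ring.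
      by rewrite c2; ring.
    have ec : c ^+ i.+3 = c ^+ 2 * c ^+ i.+1 by rewrite -exprD.
    rewrite ec; move: ('C(n, i.+3)) ('C(n.-2, i.+1)) ((i + 3) * (i + 2))%N => u v w h.
    transitivity (w%:Z * u%:Z * (c ^+ 2 * c ^+ i.+1 * r i.+3)); first by ring.
    by rewrite h; ring.
  rewrite /M => /eqP; rewrite mulf_eq0 expf_eq0 /= => /orP[|/eqP //]; rewrite mulf_eq0; lia.
- have r1 : r 1%N = -2 by rewrite /r He n4.
  have r2 : r 2%N = 2 by rewrite /r He n4.
  move=> E.
  have ep1 : ep = 1.
    move: S4 E; rewrite t0 E1 r1 /t r2 Ed => /dvdzP[q ->]. clear -hep. nia.
  move: E; rewrite ep1 t0.
  pose M := 2 * n%:Z * c.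
  have -> : t 1%N = - M by rewrite E1 r1 /M; ring.
  move=> E; have : M = 0.
    apply: (@dominant_term_eq0 M m.+1 (fun i => t i.+2)); first by rewrite big_ord_recl /bump /=; apply: (addrI (1 - M)); rewrite addrA E subrK.
    move=> M0 [[|i] hi].
      apply: (@dvdz_pow2_quot M _ (c * (n./2)%:Z) 1 1) => //; first exact: dvdz_mulr.
      have n2 : n%:Z = 2 * (n./2)%:Z + 1 by lia.
      rewrite /t /M r2 mul1r /= (_ : _ * 2 = (2 * 'C(n, 2)%:Z) * c ^+ 2); last by ring.
      rewrite -hbin {2}n2; ring.
    (* One absorption, [(i+3) 'C(n, i+3) = n 'C(n-1, i+2)], suffices here; the extra 2 in
       [2 * (i+3)] is the one inside [M]. *)
    apply: (@dvdz_pow2_quot M _ ('C(n.-1, i.+2)%:Z * c ^+ i.+2 * r i.+3) (2 * (i + 3)) (i + 4)) => //.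
    + rewrite muln_gt0 -[(i + 4)%N]/(i + (1 + 3))%N addnCA expnS ltn_pmul2l //= (leq_ltn_trans _ (two_pow_bound i)) ?leq_pmulr //; lia.
    + by apply: stormer_tail_dvd => //; lia.
    have b1 := mul_bin_diag n i.+2.
    have b2 : (i + 3)%N%:Z * 'C(n, i.+3)%:Z = n%:Z * 'C(n.-1, i.+2)%:Z.
      by move: b1; lia.
    have ec : c ^+ i.+3 = c * c ^+ i.+2 by rewrite exprS.
    rewrite -/(t i.+3) /t /M ec PoszM.
    transitivity (2 * ((i + 3)%N%:Z * 'C(n, i.+3)%:Z) * (c * c ^+ i.+2 * r i.+3)); first by ring.
    by rewrite b2; ring.
  rewrite /M => /eqP; rewrite mulf_eq0; lia.
Qed.

Lemma expn_scale_sub (g h : gint) a n : g - h = gofint a ->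
  exists q, g ^+ n = gofint a * q + h ^+ n.
Proof.
move=> E; exists (\sum_(i < n) g ^+ (n.-1 - i) * h ^+ i).
by rewrite -E -subrXX subrK.
Qed.

Lemma gi4 : gi ^+ 4 = 1. Proof. exact: gintP. Qed.

(** The square of an odd [n] is 1 modulo 4, so every unit of Z[i] is an [n]-th power and can be
    absorbed into one. *)
Lemma odd_sqr_gi_exp n j : odd n -> gi ^+ (j * n * n) = gi ^+ j.
Proof.
move=> on; have E : (n * n = 4 * (n./2 * n./2 + n./2) + 1)%N by nia.
by rewrite -mulnA E mulnDr muln1 exprD mulnCA exprM gi4 expr1n mul1r.
Qed.

Lemma stormer_even x (y : int) n : odd n -> (1 < n)%N -> (2 %| x)%Z ->
  x ^+ 2 + (x + 1) ^+ 2 = y ^+ n -> x = 0.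
Proof.
move=> on n1 x2 E.
have n0 : n = n.-1.+1 by lia.
have [j [d [_ hd]]] : exists j d, (j < 4)%N /\ Gint (x + 1) x = gi ^+ j * d ^+ n.
  by rewrite n0; apply: (@consecutive_squares_expn x y); rewrite -n0.
have {hd}[g hg] : exists g, g ^+ n = Gint (x + 1) x.
  by exists (gi ^+ (j * n) * d); rewrite exprMn -exprM odd_sqr_gi_exp.
(* For this e the number (1+i) e^n is purely imaginary, so with g = ep + b e the real part of
   (1+i) g^n is a multiple of ep. *)
pose e := (if n %% 4 == 1 then gi1 else Gint (-1) 1)%N.
have [ep [b Eg]] : exists ep b, g = gofint ep + gofint b * e.
  case: g {hg} => a b; rewrite /e; case: ifP => _.
    by exists (a - b), b; apply: gintP; rewrite /=; ring.
  by exists (a + b), b; apply: gintP; rewrite /=; ring.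
have h1 : gre (gi1 * g ^+ n) = 1 by rewrite hg /=; ring.
have [q hq] : exists q, g ^+ n = gofint ep * q + (gofint b * e) ^+ n.
  by apply: expn_scale_sub; rewrite Eg addrK.
have hep : ep = 1 \/ ep = -1.
  move: h1; rewrite hq mulrDr exprMn -rmorphXn mulrCA [gi1 * (_ * e ^+ n)]mulrCA.
  rewrite greD !gre_scale (base_re on) // mulr0 addr0.
  move: (gre _) => w {}h.
  have /eqP : (absz ep * absz w = 1)%N by rewrite -abszM h.
  by rewrite muln_eq1; lia.
have epn : ep ^+ n = ep by case: hep => ->; rewrite ?expr1n // -signr_odd on expr1.
(* If [b] were odd, the real part of [g], congruent to [ep + b] modulo 2, would be even; then [x],
   the imaginary part of [g ^+ n], would be congruent to [b ^+ n] modulo 2, hence odd. *)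
have hb : (2 %| b)%Z.
  have [q' hq'] : exists q, g ^+ n = gofint (gre g) * q + (gofint (gim g) * gi) ^+ n.
    by apply: expn_scale_sub; case: (g) => u v; apply: gintP; rewrite /=; ring.
  have Ex : x = gre g * gim q' + gim g ^+ n * gim (gi ^+ n).
    by rewrite -gim_scale -gim_scale -gimD rmorphXn -exprMn -hq' hg.
  have n4 : (n %% 4 = 1 \/ n %% 4 = 3)%N by clear -on; lia.
  have gin : gim (gi ^+ n) = 1 \/ gim (gi ^+ n) = -1.
    have -> : (n = 4 * (n %/ 4) + n %% 4)%N by rewrite mulnC -divn_eq.
    rewrite exprD exprM gi4 expr1n mul1r.
    by case: n4 => ->; [left | right].
  have bg : gim g = b by rewrite Eg gimD gim_scale /= add0r /e; case: ifP => _; rewrite /= mulr1.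
  have ag : (2 %| gre g - ep - b)%Z.
    rewrite Eg greD gre_scale /= /e; case: ifP => _ /=; apply/dvdzP; [exists 0|exists (- b)]; ring.
  apply: contraT => bo.
  have b2 : ~~ (2 %| b ^+ n)%Z by rewrite dvdzE abszX Euclid_dvdX //; move: bo; rewrite dvdzE => /negbTE->.
  have /dvdzP[A EA] : (2 %| gre g)%Z by move: (gre g) ag => A; clear -hep bo; case: hep => ->; lia.
  move: Ex; rewrite bg EA mulrAC; move: (b ^+ n) b2 (A * gim q') => B hB Q.
  by clear -gin x2 hB; case: gin => ->; lia.
pose c := ep * b.
have Eg2 : g = gofint ep * (1 + gofint c * e).
  rewrite Eg mulrDr mulr1 mulrA -rmorphM /c mulrA.
  by rewrite (_ : ep * ep = 1) ?mul1r //; case: hep => ->.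
have c0 : c = 0.
  apply: (@stormer_even_eq0 n c ep e) => //; first exact: dvdz_mull.
  move: h1; rewrite Eg2 exprMn -rmorphXn epn mulrCA gre_scale.
  by move: (gre _) => w; clear -hep; case: hep => ->; lia.
have : gim (g ^+ n) = 0.
  by rewrite Eg2 c0 rmorph0 mul0r addr0 mulr1 -rmorphXn.
by rewrite hg.
Qed.

Theorem stormer x (y : int) n : odd n -> (1 < n)%N ->
  x ^+ 2 + (x + 1) ^+ 2 = y ^+ n -> x = 0 \/ x = -1.
Proof.
move=> on n1 E; have [hx|hx] := boolP (2 %| x)%Z.
  by left; apply: (stormer_even on n1 hx E).
(* The reflection of [x] to [-1 - x] exchanges the two squares and changes the parity. *)
have : - 1 - x = 0.
  apply: (@stormer_even _ y n on n1); first by lia.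
  by rewrite -E; ring.
lia.
Qed.

(** * Pade approximants of the fourth root *)

(** [pprod n] and [mprod n] are [4 ^ n] times the rising factorials of 5/4 and 3/4, the denominators
    of the hypergeometric Pade approximants of t^(1/4). *)
Definition pprod n := (\prod_(l < n) (4 * l + 5))%N.
Definition mprod n := (\prod_(l < n) (4 * l + 3))%N.

Lemma pprodS n : pprod n.+1 = (pprod n * (4 * n + 5))%N.
Proof. by rewrite /pprod big_ord_recr. Qed.
Lemma mprodS n : mprod n.+1 = (mprod n * (4 * n + 3))%N.
Proof. by rewrite /mprod big_ord_recr. Qed.
Lemma pprod_gt0 n : (0 < pprod n)%N.
Proof. by apply: prodn_gt0 => i; rewrite addnS. Qed.
Lemma mprod_gt0 n : (0 < mprod n)%N.
Proof. by apply: prodn_gt0 => i; rewrite addnS. Qed.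

Lemma rising_prod_bin e k : (\prod_(l < k) (e + l) = 'C((e + k).-1, k) * k`!)%N.
Proof.
elim: k => [|k IH]; first by rewrite big_ord0 addn0 bin0.
rewrite big_ord_recr /= IH addnS /= factS mulnA -[('C(_, _) * k.+1)%N]mulnC.
by rewrite -mul_bin_diag; ring.
Qed.

(** The valuation of (2t)! is t more than that of t!, and an odd last factor adds nothing. *)
Lemma logn2_fact_le k : (logn 2 k`! <= k)%N.
Proof.
elim/ltn_ind: k => k IH; case: k IH => // k IH.
have dbl (t : nat) : (logn 2 (2 * t)`! = t + logn 2 t`!)%N.
  elim: t => // t IHt; have -> : (2 * t.+1 = (2 * t).+2)%N by lia.
  rewrite !factS !lognM ?muln_gt0 ?fact_gt0 // IHt.
  have -> : logn 2 (2 * t).+1 = 0%N by rewrite lognE dvdn2 /= oddM.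
  have -> : ((2 * t).+2 = 2 * t.+1)%N by lia.
  by rewrite lognM // logn_prime //=; lia.
have hd := odd_double_half k.+1; rewrite -muln2 mulnC in hd.
have := IH k.+1./2 _; have := dbl k.+1./2.
case: (odd _) hd => /= hd; rewrite -hd.
  rewrite add1n factS lognM ?fact_gt0 //.
  have -> : logn 2 (2 * k.+1./2).+1 = 0%N by rewrite lognE dvdn2 /= oddM.
  by move=> ->; lia.
by move=> ->; lia.
Qed.

(* Modulo the odd part of k!, the progression 4 l + a is 4 times a run of consecutive integers. *)
Lemma fact_dvd_arith_prod a k : (k`! %| 2 ^ k * \prod_(l < k) (4 * l + a))%N.
Proof.
have f0 := fact_gt0 k.
rewrite -(partnC 2%N f0) Gauss_dvd ?coprime_partC //; apply/andP; split.
  by apply: dvdn_mulr; rewrite p_part dvdn_exp2l // logn2_fact_le.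
apply: dvdn_mull; set o := (k`!`_2^')%N.
have oo : odd o by rewrite odd_2'nat part_pnat.
pose e := (a * (o.+1./2 * o.+1./2))%N.
have E l : (4 * l + a = 4 * (e + l) %[mod o])%N.
  have Eo : (o.+1./2 * 2 = o.+1)%N by have := odd_double_half o.+1; rewrite /= oo; lia.
  have -> : (4 * (e + l) = a * (o + 2) * o + (4 * l + a))%N by rewrite /e; nia.
  by rewrite modnMDl.
have : (\prod_(l < k) (4 * l + a) = \prod_(l < k) (4 * (e + l)) %[mod o])%N.
  by elim/big_rec2: _ => // i x y _ h; rewrite -modnMm h E modnMm.
move=> h; rewrite /dvdn h -/(dvdn _ _) big_split /= rising_prod_bin.
by apply: dvdn_mull; apply: dvdn_mull; rewrite /o dvdn_part.
Qed.

(** Both divisions are exact by [fact_dvd_arith_prod]. This is the coefficient of T^j S^k after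
    clearing denominators with [2 ^ r * pprod r * mprod r], r = j + k, so the approximants have
    integer coefficients. *)
Definition pcoef j k : nat :=
  ((2 ^ k * \prod_(l < k) (4 * l + (4 * j + 5))) %/ k`! *
   ((2 ^ j * \prod_(l < j) (4 * l + (4 * k + 3))) %/ j`!))%N.

Lemma pprodD j k : (pprod (j + k) = pprod j * \prod_(l < k) (4 * l + (4 * j + 5)))%N.
Proof.
elim: k => [|k IH]; first by rewrite big_ord0 addn0 muln1.
by rewrite addnS pprodS IH big_ord_recr /= -mulnA; congr (_ * (_ * _))%N; ring.
Qed.
Lemma mprodD j k : (mprod (k + j) = mprod k * \prod_(l < j) (4 * l + (4 * k + 3)))%N.
Proof.
elim: j => [|j IH]; first by rewrite big_ord0 addn0 muln1.
by rewrite addnS mprodS IH big_ord_recr /= -mulnA; congr (_ * (_ * _))%N; ring.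
Qed.

Lemma pcoefE j k : (pcoef j k * (pprod j * j`! * (mprod k * k`!)) =
  2 ^ (j + k) * pprod (j + k) * mprod (j + k))%N.
Proof.
rewrite /pcoef expnD pprodD [in mprod (j + k)]addnC mprodD.
have := divnK (fact_dvd_arith_prod (4 * j + 5) k).
have := divnK (fact_dvd_arith_prod (4 * k + 3) j).
move: (_ %/ k`!)%N (_ %/ j`!)%N => u v.
move: (\prod_(l < k) _)%N (\prod_(l < j) _)%N => a b hv hu.
transitivity ((u * k`!) * (v * j`!) * (pprod j * mprod k))%N; first by ring.
by rewrite hu hv; ring.
Qed.

Section Pade.
Variables (F : numFieldType) (T S : F).

(** [xser] and [yser] are the terms of the series 0F1(5/4; T/4) and 0F1(3/4; S/4). *)
Definition xser j : F := T ^+ j / (pprod j * j`!)%:R.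
Definition yser k : F := S ^+ k / (mprod k * k`!)%:R.
(* Up to the factor pprod r * mprod r, the homogenized denominator of the [r/r] Pade approximant of
   t^(1/4) at t = T / S. *)
Definition pade r : F := \sum_(j < r.+1) xser j * yser (r - j).

Lemma xserS j : T * xser j = (j.+1%:R * (4 * j.+1%:R + 1)) * xser j.+1.
Proof.
rewrite /xser pprodS factS exprS !(natrM, natrD).
have h1 : (pprod j)%:R != 0 :> F by rewrite pnatr_eq0 -lt0n pprod_gt0.
have h2 : (j`!)%:R != 0 :> F by rewrite pnatr_eq0 -lt0n fact_gt0.
have h3 : j%:R + 1 != 0 :> F by rewrite natr1 pnatr_eq0.
have h4 : 4 * j%:R + 5 != 0 :> F by rewrite -natrM -natrD pnatr_eq0 addnS.
by rewrite -natr1; field; rewrite ?h1 ?h2 ?h3 ?h4.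
Qed.

Lemma yserS k : S * yser k = (k.+1%:R * (4 * k.+1%:R - 1)) * yser k.+1.
Proof.
rewrite /yser mprodS factS exprS !(natrM, natrD).
have h1 : (mprod k)%:R != 0 :> F by rewrite pnatr_eq0 -lt0n mprod_gt0.
have h2 : (k`!)%:R != 0 :> F by rewrite pnatr_eq0 -lt0n fact_gt0.
have h3 : k%:R + 1 != 0 :> F by rewrite natr1 pnatr_eq0.
have h4 : 4 * k%:R + 3 != 0 :> F by rewrite -natrM -natrD pnatr_eq0 addnS.
by rewrite -natr1; field; rewrite ?h1 ?h2 ?h3 ?h4.
Qed.

Lemma mul_T_sum (w : nat -> F) r :
  T * \sum_(j < r.+1) w j * (xser j * yser (r - j)) =
  \sum_(j < r.+2) (j%:R * (4 * j%:R + 1) * w j.-1) * (xser j * yser (r.+1 - j)).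
Proof.
rewrite [RHS]big_ord_recl /= !mul0r add0r mulr_sumr; apply: eq_bigr => j _.
rewrite /bump /= add1n subSS -(mulrA _ (w j)) mulrCA [T * (_ * _)]mulrA xserS; ring.
Qed.

Lemma mul_S_sum (w : nat -> F) r :
  S * \sum_(j < r.+1) w j * (xser j * yser (r - j)) =
  \sum_(j < r.+2) ((r.+1 - j)%:R * (4 * (r.+1 - j)%:R - 1) * w j) *
    (xser j * yser (r.+1 - j)).
Proof.
rewrite [RHS]big_ord_recr /= subnn !mul0r addr0 mulr_sumr; apply: eq_bigr => j _.
rewrite subSn -1?ltnS // [S * (_ * _)]mulrCA [S * (_ * _)]mulrCA yserS; ring.
Qed.

Lemma padeE r : pade r = \sum_(j < r.+1) 1 * (xser j * yser (r - j)).
Proof. by apply: eq_bigr => j _; rewrite mul1r. Qed.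

Lemma mul_addTS_pade r : (T + S) * pade r.+1 = \sum_(j < r.+3)
  (j%:R * (4 * j%:R + 1) + (r.+2 - j)%:R * (4 * (r.+2 - j)%:R - 1)) *
    (xser j * yser (r.+2 - j)).
Proof.
rewrite mulrDl !padeE (mul_T_sum (fun=> 1)) (mul_S_sum (fun=> 1)) -big_split /=.
by apply: eq_bigr => j _; rewrite !mulr1 -mulrDl.
Qed.

Lemma mul_sqrTS_pade r : (T - S) ^+ 2 * pade r = \sum_(j < r.+3)
  (j%:R * (4 * j%:R + 1) * (j.-1%:R * (4 * j.-1%:R + 1))
   - 2 * (j%:R * (4 * j%:R + 1) *
       ((r.+1 - j.-1)%:R * (4 * (r.+1 - j.-1)%:R - 1)))
   + (r.+2 - j)%:R * (4 * (r.+2 - j)%:R - 1) *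
       ((r.+1 - j)%:R * (4 * (r.+1 - j)%:R - 1))) *
    (xser j * yser (r.+2 - j)).
Proof.
have -> : (T - S) ^+ 2 * pade r = T * (T * pade r) - 2 * (T * (S * pade r)) + S * (S * pade r).
  by ring.
rewrite !padeE (mul_T_sum (fun=> 1)) (mul_S_sum (fun=> 1)).
rewrite (mul_T_sum (fun j => j%:R * (4 * j%:R + 1) * 1)).
rewrite (mul_T_sum (fun j => (r.+1 - j)%:R * (4 * (r.+1 - j)%:R - 1) * 1)).
rewrite (mul_S_sum (fun j => (r.+1 - j)%:R * (4 * (r.+1 - j)%:R - 1) * 1)).
rewrite mulr_sumr -sumrB -big_split /=.
by apply: eq_bigr => j _; ring.
Qed.

(* Multiplying by T or S only reweights the summands x_j y_k of the next convolution (mul_T_sum,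
   mul_S_sum), so the recurrence is a polynomial identity in j and r. *)
Lemma pade_rec r :
  (r%:R + 1) * (r%:R + 2) * (16 * (r%:R + 2) ^+ 2 - 1) * pade r.+2 =
  4 * (r%:R + 1) * (2 * r%:R + 3) * ((T + S) * pade r.+1) - (T - S) ^+ 2 * pade r.
Proof.
rewrite mul_addTS_pade mul_sqrTS_pade padeE !mulr_sumr -sumrB.
apply: eq_bigr => j _; rewrite !mulrA -!mulrBl; congr (_ * _ * _).
have jr : (j <= r.+2)%N by rewrite -ltnS.
have Er : r.+2%:R = r%:R + 2 :> F by rewrite -natrD addn2.
rewrite natrB // Er; case: (nat_of_ord j) jr => [|i] ir /=.
  by rewrite !subn0 -[r.+1%:R]natr1; ring.
have [/eqP ->|{}ir] : i == r.+1 \/ (i <= r)%N by lia.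
  by rewrite subnn -[r.+2%:R]natr1 -![r.+1%:R]natr1; ring.
have E1 : (r.+1 - i)%:R = r%:R + 1 - i%:R :> F by rewrite natrB -?natr1 //; lia.
have E2 : (r.+1 - i.+1)%:R = r%:R - i%:R :> F by rewrite subSS natrB.
by rewrite E1 E2 -[i.+1%:R]natr1; ring.
Qed.

Definition spade r : F := \sum_(j < r.+1) (pcoef j (r - j))%:R * (T ^+ j * S ^+ (r - j)).

Lemma spadeE r : spade r = (2 ^ r * pprod r * mprod r)%:R * pade r.
Proof.
rewrite mulr_sumr; apply: eq_bigr => j _.
have jr : (j + (r - j) = r)%N by rewrite subnKC // -ltnS.
have E := pcoefE j (r - j); rewrite jr in E.
have h1 : (0 < pprod j * j`!)%N by rewrite muln_gt0 pprod_gt0 fact_gt0.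
have h2 : (0 < mprod (r - j) * (r - j)`!)%N by rewrite muln_gt0 mprod_gt0 fact_gt0.
rewrite -E /xser /yser.
move: (pcoef _ _) (pprod j * _)%N (mprod (r - j) * _)%N h1 h2 (_ ^+ j) (_ ^+ (r - j)).
move=> c u v u0 v0 t s; rewrite !natrM; field.
by rewrite !pnatr_eq0 -!lt0n u0 v0.
Qed.

(** The factor 16(r+2)^2 - 1 = (4r+7)(4r+9) of [pade_rec] cancels against the newest factors of
    [mprod] and [pprod]. *)
Lemma spade_rec r : (r%:R + 1) * (r%:R + 2) * spade r.+2 =
  8 * (r%:R + 1) * (2 * r%:R + 3) * ((T + S) * spade r.+1)
  - 4 * (4 * r%:R + 5) * (4 * r%:R + 3) * ((T - S) ^+ 2 * spade r).
Proof.
rewrite !spadeE !pprodS !mprodS !expnS.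
have -> : (4 * r.+1 + 5 = 4 * r + 9)%N by ring.
have -> : (4 * r.+1 + 3 = 4 * r + 7)%N by ring.
rewrite !(natrM, natrD).
transitivity (4 * (2 ^ r)%:R * (pprod r)%:R * (mprod r)%:R * (4 * r%:R + 5) * (4 * r%:R + 3) *
  ((r%:R + 1) * (r%:R + 2) * (16 * (r%:R + 2) ^+ 2 - 1) * pade r.+2)); first by ring.
by rewrite pade_rec; ring.
Qed.

End Pade.

(** * Gaussian integer approximants at 239 + i *)

Definition toC (z : gint) : realalg[i] := Complex (gre z)%:~R (gim z)%:~R.

Lemma toC_is_additive : zmod_morphism toC.
Proof. by move=> x y; apply/eqP; rewrite eq_complex /= !rmorphB !eqxx. Qed.
Lemma toC_is_multiplicative : monoid_morphism toC.
Proof.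
split=> [|x y]; apply/eqP; rewrite eq_complex /= ?eqxx //.
by rewrite rmorphB rmorphD !rmorphM !eqxx.
Qed.
HB.instance Definition _ := GRing.isZmodMorphism.Build gint realalg[i] toC toC_is_additive.
HB.instance Definition _ :=
  GRing.isMonoidMorphism.Build gint realalg[i] toC toC_is_multiplicative.

Lemma toCD x y : toC (x + y) = toC x + toC y. Proof. exact: rmorphD. Qed.
Lemma toC_natM n x : toC (n%:R * x) = n%:R * toC x.
Proof. by rewrite -(rmorph_nat toC) -rmorphM. Qed.

Lemma toC_inj : injective toC.
Proof.
by move=> [a b] [c d] /eqP; rewrite eq_complex /= !eqr_int => /andP[/eqP-> /eqP->].
Qed.

(* 239^2 + 1 = 2 * 13^4 is the nontrivial solution of X^2 + 1 = 2 Y^4. *)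
Definition appr r : gint :=
  \sum_(j < r.+1) (pcoef j (r - j))%:R * (Gint 239 1 ^+ j * Gint 239 (-1) ^+ (r - j)).

Lemma toC_appr r : toC (appr r) = spade (toC (Gint 239 1)) (toC (Gint 239 (-1))) r.
Proof.
rewrite /appr rmorph_sum; apply: eq_bigr => j _.
by rewrite rmorphM rmorph_nat rmorphM !rmorphXn.
Qed.

(** Here T + S = 478 and (T - S)^2 = -4; the recurrence is proved in the field [realalg[i]] and
    pulled back along the injection [toC]. *)
Lemma appr_rec r : ((r + 1) * (r + 2))%:R * appr r.+2 =
  (3824 * ((r + 1) * (2 * r + 3)))%:R * appr r.+1 + (16 * (4 * r + 5) * (4 * r + 3))%:R * appr r.
Proof.
apply: toC_inj; rewrite toCD !toC_natM !toC_appr.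
have hTS : toC (Gint 239 1) + toC (Gint 239 (-1)) = 478%:R.
  by rewrite -rmorphD -(rmorph_nat toC); congr (toC _); apply: gintP.
have hTS2 : (toC (Gint 239 1) - toC (Gint 239 (-1))) ^+ 2 = - 4%:R.
  by rewrite -rmorphB -rmorphXn -(rmorph_nat toC) -rmorphN; congr (toC _); apply: gintP.
have := spade_rec (toC (Gint 239 1)) (toC (Gint 239 (-1))) r; rewrite hTS hTS2.
move: (spade _ _ r.+2) (spade _ _ r.+1) (spade _ _ r) => a b c h.
rewrite !(natrM, natrD).
transitivity ((r%:R + 1) * (r%:R + 2) * a); first by ring.
by rewrite h; ring.
Qed.

Lemma appr0 : appr 0 = 1.
Proof. by rewrite /appr big_ord_recl big_ord0 /pcoef !big_ord0 /= divnn; apply: gintP. Qed.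
Lemma appr1 : appr 1 = Gint 3824 (-4).
Proof.
by rewrite /appr 2!big_ord_recl big_ord0 /pcoef !big_ord_recr !big_ord0; apply: gintP.
Qed.

Lemma gre_appr_rec r : ((r + 1) * (r + 2))%:Z * gre (appr r.+2) =
  (3824 * ((r + 1) * (2 * r + 3)))%:Z * gre (appr r.+1)
  + (16 * (4 * r + 5) * (4 * r + 3))%:Z * gre (appr r).
Proof. by rewrite -!gre_natM -greD appr_rec. Qed.

Lemma gim_appr_rec r : ((r + 1) * (r + 2))%:Z * gim (appr r.+2) =
  (3824 * ((r + 1) * (2 * r + 3)))%:Z * gim (appr r.+1)
  + (16 * (4 * r + 5) * (4 * r + 3))%:Z * gim (appr r).
Proof. by rewrite -!gim_natM -gimD appr_rec. Qed.

(** This Casorati determinant starts at 4, and the recurrence makes successive values proportional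
    with nonzero factors. *)
Lemma appr_indep r :
  gre (appr r.+1) * gim (appr r) - gre (appr r) * gim (appr r.+1) != 0.
Proof.
elim: r => [|r IH]; first by rewrite appr0 appr1.
apply: contra_neq IH => h.
have hA := gre_appr_rec r; have hB := gim_appr_rec r.
move: (gre (appr r.+2)) (gim (appr r.+2)) (gre (appr r.+1)) (gim (appr r.+1)) (gre (appr r)) (gim (appr r)) h hA hB.
move=> a2 b2 a1 b1 a0 b0 h hA hB.
have c0 : (16 * (4 * r + 5) * (4 * r + 3))%:Z != 0 by rewrite eqz_nat !muln_eq0 !addnS.
move: ((r + 1) * _)%:Z (3824 * _)%:Z (16 * _ * _)%:Z c0 hA hB => d e f f0 hA hB.
apply: (mulfI f0); rewrite mulr0.
transitivity ((d * b2 - e * b1) * a1 - (d * a2 - e * a1) * b1); first by rewrite hA hB; ring.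
by transitivity (- d * (a2 * b1 - a1 * b2)); [ring | rewrite h mulr0].
Qed.

Lemma rec_growth (d e f c E a2 a1 a0 : int) : d * a2 = e * a1 + f * a0 ->
  0 < d -> 0 <= e -> 0 <= f -> e * c + f <= d * (c * c) -> 0 <= E ->
  `|a1| <= c * E -> `|a0| <= E -> `|a2| <= c * (c * E).
Proof.
move=> h d0 e0 f0 hc E0 h1 h0; rewrite -(ler_pM2l d0).
have -> : d * `|a2| = `|d * a2| by rewrite normrM (gtr0_norm d0).
rewrite h; apply: le_trans (ler_normD _ _) _.
rewrite !normrM (ger0_norm e0) (ger0_norm f0).
apply: le_trans (lerD (ler_wpM2l e0 h1) (ler_wpM2l f0 h0)) _.
rewrite (_ : e * _ + _ = (e * c + f) * E); last by ring.
by rewrite (_ : d * _ = d * (c * c) * E) ?ler_wpM2r //; ring.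
Qed.

(** After division by (r+1)(r+2) the coefficients of the recurrence stay below 7648 and 256, and
    7648 c + 256 <= c^2 for c >= 7700. *)
Lemma appr_growth (c : int) r : 7700 <= c ->
  `|gre (appr r)| <= c ^+ r /\ `|gim (appr r)| <= c ^+ r.
Proof.
move=> c_ge.
have hc i : (3824 * ((i + 1) * (2 * i + 3)))%:Z * c + (16 * (4 * i + 5) * (4 * i + 3))%:Z
   <= ((i + 1) * (i + 2))%:Z * (c * c).
  rewrite !(PoszM, PoszD); have := le0z_nat i; move: (Posz i) => j j0.
  have h : 0 <= (c - 7700) * c by nia.
  have h' : 0 <= ((j + 1) * (j + 2)) * ((c - 7700) * c) by rewrite mulr_ge0 //; nia.
  nia.
have c0 : 0 <= c by lia.
suff : (`|gre (appr r)| <= c ^+ r /\ `|gim (appr r)| <= c ^+ r) /\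
  (`|gre (appr r.+1)| <= c ^+ r.+1 /\ `|gim (appr r.+1)| <= c ^+ r.+1) by case.
elim: r => [|r [[hA hB] [hA' hB']]].
  by rewrite appr0 appr1 !expr0 expr1 /=; split; split; lia.
have e1 := exprS c r; have e2 : c ^+ r.+2 = c * (c * c ^+ r) by rewrite -e1 -exprS.
split; first by split; assumption.
rewrite e2; rewrite e1 in hA' hB'; have E0 : 0 <= c ^+ r by rewrite exprn_ge0.
have d0 : 0 < ((r + 1) * (r + 2))%:Z by rewrite ltz_nat muln_gt0 !addnS.
split; first by apply: (rec_growth (gre_appr_rec r) d0 _ _ (hc r) E0).
by apply: (rec_growth (gim_appr_rec r) d0 _ _ (hc r) E0).
Qed.

(** * The imaginary parts as an integral *)

Section Integral.
Variable R : rcfType.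
Implicit Types (f g P : {poly R}) (q M : R).

Definition prim f : {poly R} := \poly_(i < (size f).+1) (f`_i.-1 / i%:R).

Lemma deriv_prim f : (prim f)^`() = f.
Proof.
apply/polyP => i; rewrite coef_deriv coef_poly ltnS /=.
case: ltnP => [_|/leq_sizeP/(_ i (leqnn i)) ->]; last by rewrite mul0rn.
by rewrite -[LHS]mulr_natr divfK // pnatr_eq0.
Qed.

Variable q : R.
Hypothesis q_gt0 : 0 < q.

Definition integ f := (prim f).[q] - (prim f).[0].

(** The difference of two antiderivatives has zero derivative, so the mean value theorem gives it
    equal values at 0 and [q]. *)
Lemma integ_deriv P : integ P^`() = P.[q] - P.[0].
Proof.
apply/eqP; rewrite -subr_eq0.
have [c _] := poly_mvt (prim P^`() - P) q_gt0.
by rewrite derivB deriv_prim subrr horner0 mul0r !hornerE => h; apply/eqP; rewrite -[RHS]h /integ; ring.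
Qed.

Lemma integD f g : integ (f + g) = integ f + integ g.
Proof.
rewrite -{1}(deriv_prim f) -{1}(deriv_prim g) -derivD integ_deriv !hornerD /integ; ring.
Qed.

Lemma integZ a f : integ (a *: f) = a * integ f.
Proof.
by rewrite -{1}(deriv_prim f) -derivZ integ_deriv !hornerZ /integ; ring.
Qed.

Lemma integB f g : integ (f - g) = integ f - integ g.
Proof. by rewrite integD -scaleN1r integZ mulN1r. Qed.

Lemma integ_bound f M : (forall x, 0 < x < q -> `|f.[x]| <= M) -> `|integ f| <= q * M.
Proof.
move=> h; have [c cq] := poly_mvt (prim f) q_gt0.
rewrite deriv_prim subr0 -/(integ f) => ->; rewrite normrM (gtr0_norm q_gt0) mulrC.
by rewrite ler_pM2l //; apply: h; move: cq; rewrite in_itv.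
Qed.

Variables h s : R.
(* The value of h - 2 Re(y^4) on the circle |y|^2 = s, as a polynomial in Im y. *)
Definition arcpoly : {poly R} :=
  h%:P - (s%:P ^+ 2) *+ 2 + (s%:P * 'X^2) *+ 16 - 'X^4 *+ 16.

Definition arcint r := integ (arcpoly ^+ r).

Hypothesis root_q : arcpoly.[q] = 0.
Hypothesis hm : h ^+ 2 - 4 * s ^+ 4 = - 4.

Lemma deriv_arcpoly : arcpoly^`() = (s%:P * 'X) *+ 32 - 'X^3 *+ 64.
Proof. by rewrite /arcpoly !derivE; ring. Qed.

Lemma deriv2_arcpoly : arcpoly^`()^`() = s%:P *+ 32 - 'X^2 *+ 192.
Proof. by rewrite deriv_arcpoly !derivE; ring. Qed.

(** Under x = sqrt(s) sin(theta) the polynomial is h - 2 s^2 cos(4 theta), and the left side is the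
    square of its derivative in theta; [hm] replaces 4 s^4 by h^2 + 4. In the same way
    [arcpoly_deriv2] is the second derivative in theta. *)
Lemma arcpoly_sqr_deriv :
  (s%:P - 'X^2) * arcpoly^`() ^+ 2 = 16 * (h%:P ^+ 2 + 4 - (h%:P - arcpoly) ^+ 2).
Proof.
have hmP : h%:P ^+ 2 = 4 * s%:P ^+ 4 - 4.
  have := congr1 (@polyC R) hm; rewrite polyCB polyC_exp [(4 * _)%:P]polyCM polyC_exp polyCN !polyC_natr.
  by move/(canRL (subrK _)) => ->; ring.
by rewrite hmP deriv_arcpoly /arcpoly; ring.
Qed.

Lemma arcpoly_deriv2 : (s%:P - 'X^2) * arcpoly^`()^`() - 'X * arcpoly^`() = 16 * (h%:P - arcpoly).
Proof. by rewrite deriv2_arcpoly deriv_arcpoly /arcpoly; ring. Qed.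

(* Integration by parts: the polynomial W below vanishes at both ends of the interval. *)
Lemma arcint_rec r :
  (16 * (r%:R + 2) ^+ 2 - 1) * arcint r.+2 =
  (16 * h * (2 * r%:R + 3) * (r%:R + 2)) * arcint r.+1
  + (64 * (r%:R + 1) * (r%:R + 2)) * arcint r.
Proof.
pose W := (r%:R + 2) * ((s%:P - 'X^2) * arcpoly^`() * arcpoly ^+ r.+1) + 'X * arcpoly ^+ r.+2.
have dW : W^`() = (64 * (r%:R + 1) * (r%:R + 2)) * arcpoly ^+ r
   + (16 * h%:P * (2 * r%:R + 3) * (r%:R + 2)) * arcpoly ^+ r.+1
   - (16 * (r%:R + 2) ^+ 2 - 1) * arcpoly ^+ r.+2.
  have dn : (r%:R + 2 : {poly R})^`() = 0 by rewrite -natrD -polyC_natr derivC.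
  have da : (s%:P - 'X^2)^`() = - 'X *+ 2 :> {poly R} by rewrite !derivE; ring.
  have e c a p1 p2 p3 : c^`() = 0 -> (c * (a * p1 * p2) + 'X * p3)^`() =
      c * ((a^`() * p1 + a * p1^`()) * p2 + a * p1 * p2^`()) + (p3 + 'X * p3^`()) :> {poly R}.
    by move=> dc; rewrite derivD !derivM dc derivX; ring.
  rewrite /W e // da !deriv_exp /=.
  have I1 := arcpoly_sqr_deriv; have I2 := arcpoly_deriv2.
  rewrite !(exprS _ r.+1) !(exprS _ r) -[_ * _ *+ r.+1]mulr_natr -[_ * _ *+ r.+2]mulr_natr.
  rewrite -[r.+2%:R]natr1 -![r.+1%:R]natr1.
  move: I1 I2; move: arcpoly (arcpoly ^+ r) arcpoly^`() arcpoly^`()^`() => f fr f1 f2 I1 I2.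
  transitivity (fr * ((r%:R + 2) * (f * ((s%:P - 'X^2) * f2 - 'X * f1) + (r%:R + 1) * ((s%:P - 'X^2) * f1 ^+ 2)) + f ^+ 2)); first by ring.
  by rewrite I1 I2; ring.
have := integ_deriv W; rewrite dW.
have hW c a p1 p2 p3 (x : R) :
    (c * (a * p1 * p2) + 'X * p3).[x] = c.[x] * (a.[x] * p1.[x] * p2.[x]) + x * p3.[x].
  by rewrite hornerD !hornerM hornerX.
have -> : W.[q] - W.[0] = 0.
  rewrite /W !hW !horner_exp root_q !exprS !mul0r !mulr0 addr0 sub0r.
  have -> : arcpoly^`().[0] = 0 by rewrite deriv_arcpoly hornerD hornerN !hornerMn hornerM hornerX hornerXn expr0n mulr0 !mul0rn subr0.
  by ring.
rewrite integB !integD.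
have E1 : (64 * (r%:R + 1) * (r%:R + 2)) * arcpoly ^+ r =
    (64 * (r%:R + 1) * (r%:R + 2)) *: arcpoly ^+ r.
  by rewrite -mul_polyC !polyCM !polyCD !polyC_natr.
have E2 : (16 * h%:P * (2 * r%:R + 3) * (r%:R + 2)) * arcpoly ^+ r.+1 =
    (16 * h * (2 * r%:R + 3) * (r%:R + 2)) *: arcpoly ^+ r.+1.
  by rewrite -mul_polyC !polyCM !polyCD polyCM !polyC_natr.
have E3 : (16 * (r%:R + 2) ^+ 2 - 1) * arcpoly ^+ r.+2 =
    (16 * (r%:R + 2) ^+ 2 - 1) *: arcpoly ^+ r.+2.
  by rewrite -mul_polyC polyCB [(16 * _)%:P]polyCM [(_ ^+ 2)%:P]polyC_exp [(r%:R + 2)%:P]polyCD !polyC_natr.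
rewrite E1 E2 E3 !integZ -!/(arcint _).
by move/eqP; rewrite subr_eq0 => /eqP <-; ring.
Qed.
End Integral.

(** * The fourth root u = p + iq of 239 + i, and the size of Im (u N_r) *)

Section Arc.
Variables (R : rcfType) (p q : R).
Hypotheses (q_gt0 : 0 < q) (Hre : p ^+ 4 - 6 * p ^+ 2 * q ^+ 2 + q ^+ 4 = 239)
  (Him : 4 * p ^+ 3 * q - 4 * p * q ^+ 3 = 1).

Local Notation s := (p ^+ 2 + q ^+ 2).
Local Notation arcK := (arcint q 478 s).

Lemma arcpoly_horner (x : R) :
  (arcpoly 478 s).[x] = 478 - 2 * s ^+ 2 + 16 * s * x ^+ 2 - 16 * x ^+ 4.
Proof.
rewrite /arcpoly hornerD hornerN hornerD hornerMn hornerD hornerN !hornerMn [(_ * 'X^2).[x]]hornerM.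
by rewrite !horner_exp !hornerC !hornerX; ring.
Qed.

Lemma arcpoly_root : (arcpoly 478 s).[q] = 0.
Proof. by rewrite arcpoly_horner -[478](_ : 2 * 239 = _); [rewrite -Hre; ring | ring]. Qed.

Lemma sqr_norm8 : s ^+ 4 = 239 ^+ 2 + 1.
Proof.
transitivity ((p ^+ 4 - 6 * p ^+ 2 * q ^+ 2 + q ^+ 4) ^+ 2 + (4 * p ^+ 3 * q - 4 * p * q ^+ 3) ^+ 2).
  by ring.
by rewrite Hre Him; ring.
Qed.

Lemma arc_rec r : (16 * (r%:R + 2) ^+ 2 - 1) * arcK r.+2 =
  (16 * 478 * (2 * r%:R + 3) * (r%:R + 2)) * arcK r.+1
  + (64 * (r%:R + 1) * (r%:R + 2)) * arcK r.
Proof. by apply: arcint_rec => //; [exact: arcpoly_root | rewrite sqr_norm8; ring]. Qed.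

Definition Aseq r : R := (gre (appr r))%:~R.
Definition Bseq r : R := (gim (appr r))%:~R.
(** The imaginary part of u N_r, with N_r = [appr r]. *)
Definition imu r : R := p * Bseq r + q * Aseq r.

Lemma Aseq_rec r : (r%:R + 1) * (r%:R + 2) * Aseq r.+2 =
  3824 * ((r%:R + 1) * (2 * r%:R + 3)) * Aseq r.+1 + 16 * (4 * r%:R + 5) * (4 * r%:R + 3) * Aseq r.
Proof.
have := congr1 (fun z : int => z%:~R : R) (gre_appr_rec r); rewrite intrD !intrM.
by rewrite -!pmulrn !(natrM, natrD).
Qed.

Lemma Bseq_rec r : (r%:R + 1) * (r%:R + 2) * Bseq r.+2 =
  3824 * ((r%:R + 1) * (2 * r%:R + 3)) * Bseq r.+1 + 16 * (4 * r%:R + 5) * (4 * r%:R + 3) * Bseq r.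
Proof.
have := congr1 (fun z : int => z%:~R : R) (gim_appr_rec r); rewrite intrD !intrM.
by rewrite -!pmulrn !(natrM, natrD).
Qed.

(** The normalization that turns the recurrence of the integrals [arcK] into that of [imu]; each of
    its factors is below 8. *)
Definition kap r : R := \prod_(l < r) ((16 * (l%:R + 1) ^+ 2 - 1) / (2 * (l%:R + 1) ^+ 2)).

Lemma kapS r : 2 * (r%:R + 1) ^+ 2 * kap r.+1 = (16 * (r%:R + 1) ^+ 2 - 1) * kap r.
Proof.
rewrite /kap big_ord_recr /=; have h : r%:R + 1 != 0 :> R by rewrite natr1 pnatr_eq0.
by field.
Qed.

Lemma imu0 : imu 0 = q.
Proof. by rewrite /imu /Aseq /Bseq appr0 /=; ring. Qed.
Lemma imu1 : imu 1 = 3824 * q - 4 * p.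
Proof. by rewrite /imu /Aseq /Bseq appr1 /=; ring. Qed.

Lemma arcK0 : arcK 0 = q.
Proof.
rewrite /arcint expr0 -[1]derivX integ_deriv //.
by rewrite !hornerX subr0.
Qed.
Lemma arcK1 : 15 * arcK 1 = 2 * imu 1.
Proof.
(* 15 times the antiderivative of [arcpoly], which clears the denominators 3 and 5. *)
pose P : {poly R} := ((478%:P - s%:P ^+ 2 *+ 2) * 'X) *+ 15 + (s%:P * 'X^3) *+ 80 - 'X^5 *+ 48.
have dP : P^`() = 15 *: arcpoly 478 s.
  rewrite scaler_nat /P /arcpoly derivB derivD !derivMn [(_ * 'X)^`()]derivM.
  rewrite [(_ * 'X^3)^`()]derivM derivX !derivXn derivB derivMn deriv_exp !derivC /=.
  by move: (478%:P) (s%:P) => H S; ring.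
have Px (x : R) : P.[x] = ((478 - s ^+ 2 *+ 2) * x) *+ 15 + (s * x ^+ 3) *+ 80 - x ^+ 5 *+ 48.
  rewrite /P hornerD hornerN hornerD !hornerMn [(_ * 'X).[x]]hornerM [(_ * 'X^3).[x]]hornerM.
  by rewrite hornerD hornerN hornerMn !horner_exp !hornerC !hornerX.
have := integ_deriv q_gt0 P; rewrite dP integZ // !Px /arcint expr1 => ->.
rewrite imu1.
transitivity (((2 * (p ^+ 4 - 6 * p ^+ 2 * q ^+ 2 + q ^+ 4) - s ^+ 2 *+ 2) * q) *+ 15
   + (s * q ^+ 3) *+ 80 - q ^+ 5 *+ 48); first by rewrite Hre; ring.
transitivity (2 * (16 * (p ^+ 4 - 6 * p ^+ 2 * q ^+ 2 + q ^+ 4) * q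
   - 4 * p * (4 * p ^+ 3 * q - 4 * p * q ^+ 3))); first by ring.
by rewrite Hre Him; ring.
Qed.

(** Both sides satisfy the same second-order recurrence and agree at 0 and 1. *)
Lemma imuE r : imu r = kap r * arcK r.
Proof.
suff : imu r = kap r * arcK r /\ imu r.+1 = kap r.+1 * arcK r.+1 by case.
elim: r => [|r [IH IH1]].
  rewrite imu0 arcK0 /kap big_ord0 mul1r big_ord_recl big_ord0; split=> //.
  have h2 : 2 != 0 :> R by rewrite pnatr_eq0.
  by apply: (mulfI h2); rewrite -arcK1 /=; field.
split; first exact: IH1.
have r1 : r%:R + 1 != 0 :> R by rewrite natr1 pnatr_eq0.
have r2 : r%:R + 2 != 0 :> R by rewrite -natrD pnatr_eq0 addn2.
have h : (r%:R + 1) * (r%:R + 2) * imu r.+2 =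
  3824 * ((r%:R + 1) * (2 * r%:R + 3)) * imu r.+1 + 16 * (4 * r%:R + 5) * (4 * r%:R + 3) * imu r.
  rewrite /imu; transitivity (p * ((r%:R + 1) * (r%:R + 2) * Bseq r.+2) +
    q * ((r%:R + 1) * (r%:R + 2) * Aseq r.+2)); first by ring.
  by rewrite Aseq_rec Bseq_rec; ring.
have h2 : 2 != 0 :> R by rewrite pnatr_eq0.
apply: (mulfI (mulf_neq0 r1 r2)); rewrite h IH IH1.
have k1 := kapS r; have := kapS r.+1; rewrite -[r.+1%:R]natr1 => k2.
have ar := arc_rec r.
move: (kap r.+2) (kap r.+1) (kap r) (arcK r.+2) (arcK r.+1) (arcK r) k1 k2 ar.
move: (r%:R) r1 r2 => x x1 x2 c2 c1 c0 K2 K1 K0 k1 k2 ar.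
apply: (mulfI (mulf_neq0 h2 x2)).
transitivity ((x + 1) * c1 * ((16 * 478 * (2 * x + 3) * (x + 2)) * K1) +
   (x + 2) * 32 * ((16 * (x + 1) ^+ 2 - 1) * c0) * K0); first by ring.
rewrite -k1.
transitivity ((x + 1) * c1 * ((16 * (x + 2) ^+ 2 - 1) * K2)); first by rewrite ar; ring.
transitivity ((x + 1) * K2 * ((16 * (x + 1 + 1) ^+ 2 - 1) * c1)); first by ring.
by rewrite -k2; ring.
Qed.

Lemma kap_bound r : 0 <= kap r <= 8 ^+ r.
Proof.
elim: r => [|r /andP[IH1 IH2]]; first by rewrite /kap big_ord0 expr0 ler01 lexx.
have r0 : 0 <= r%:R :> R by rewrite ler0n.
have d0 : 0 < 2 * (r%:R + 1) ^+ 2 :> R by nra.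
have h := kapS r; have n0 : 0 <= 16 * (r%:R + 1) ^+ 2 - 1 :> R by nra.
apply/andP; split.
  by rewrite -(pmulr_rge0 _ d0) h mulr_ge0.
rewrite -(ler_pM2l d0) h (exprS 8 r); apply: le_trans (ler_wpM2l n0 IH2) _.
rewrite (mulrA _ 8); apply: ler_wpM2r; first by rewrite exprn_ge0.
nra.
Qed.

(** The polynomial equals -16 (q^2 - x^2)(p^2 - x^2), hence is nonpositive on the interval; it is
    also at least 478 - 2 s^2, and s^2, the square root of 239^2 + 1, exceeds 239 by at most
    1/478. *)
Lemma arcpoly_bound (x : R) : 0 < x < q -> q < p -> `|(arcpoly 478 s).[x]| <= 239^-1.
Proof.
move=> /andP[x0 xq] qp; have := arcpoly_root; rewrite !arcpoly_horner => hq.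
have hs : 239 <= s ^+ 2 <= 239 + 478^-1.
  have s2 : 0 <= s ^+ 2 by rewrite sqr_ge0.
  have := sqr_norm8; rewrite (_ : s ^+ 4 = s ^+ 2 ^+ 2); last by rewrite -exprM.
  move: (s ^+ 2) s2 => t t0 ht; apply/andP; split; nra.
have hx : 0 <= x ^+ 2 * (s - x ^+ 2) by rewrite mulr_ge0 ?sqr_ge0 //; nra.
have hle : 478 - 2 * s ^+ 2 + 16 * s * x ^+ 2 - 16 * x ^+ 4 <= 0.
  rewrite -hq -subr_ge0 (_ : _ - _ = 16 * ((q ^+ 2 - x ^+ 2) * (p ^+ 2 - x ^+ 2))); last by ring.
  by rewrite !mulr_ge0 //; nra.
rewrite ler0_norm //.
have : 16 * s * x ^+ 2 - 16 * x ^+ 4 = 16 * (x ^+ 2 * (s - x ^+ 2)) by ring.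
move: (s ^+ 2) hs (_ * _ * x ^+ 2) (16 * x ^+ 4) => t ht u v; move: (x ^+ 2 * _) hx => w hw hu.
have : 478^-1 * 2 = 239^-1 :> R by field.
move: (478^-1) ht (239^-1) => a ht b; lra.
Qed.

Lemma imu_bound r : q < p -> `|imu r| <= q * (8 / 239) ^+ r.
Proof.
move=> qp; rewrite imuE normrM; have /andP[k0 k8] := kap_bound r.
have : `|arcK r| <= q * 239^-1 ^+ r.
  apply: integ_bound => // x hx; rewrite horner_exp normrX.
  by apply: lerXn2r; rewrite ?nnegrE ?invr_ge0 ?ler0n // arcpoly_bound.
rewrite (ger0_norm k0) => h; apply: le_trans (ler_pM k0 (normr_ge0 _) k8 h) _.
by rewrite mulrCA -exprMn.
Qed.
End Arc.

(** * Thue's method *)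

Lemma complex_sqrt (R : rcfType) (a b : R) : 0 < a -> 0 < b ->
  exists x y, [/\ 0 < x, 0 < y, x ^+ 2 - y ^+ 2 = a & 2 * x * y = b].
Proof.
move=> a0 b0; pose n := Num.sqrt (a ^+ 2 + b ^+ 2).
have n2 : n ^+ 2 = a ^+ 2 + b ^+ 2 by rewrite sqr_sqrtr // addr_ge0 ?sqr_ge0.
have n0 : 0 <= n by rewrite sqrtr_ge0.
have na : 0 < (n + a) / 2 by rewrite divr_gt0 // ltr_wpDl.
pose x := Num.sqrt ((n + a) / 2).
have x0 : 0 < x by rewrite sqrtr_gt0.
have x2 : x ^+ 2 = (n + a) / 2 by rewrite sqr_sqrtr // ltW.
exists x, (b / (2 * x)); split=> //; first by rewrite divr_gt0 // mulr_gt0.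
  have E : (b / (2 * x)) ^+ 2 = b ^+ 2 / (4 * x ^+ 2) by field; rewrite gt_eqF.
  rewrite E x2; have -> : b ^+ 2 = n ^+ 2 - a ^+ 2 by rewrite n2; ring.
  have : n + a != 0 by rewrite gt_eqF // ltr_wpDl.
  by move=> h; field.
by field; rewrite gt_eqF.
Qed.

(** Two successive complex square roots of 239 + i; numerically [p] is about 3.932 and [q] about
    0.0041. *)
Lemma fourth_root_exists (R : rcfType) : exists p q : R,
  [/\ 0 < q <= 5 / 1000, q < p, p + q <= 4, 15 <= p ^+ 2 + q ^+ 2 &
    p ^+ 4 - 6 * p ^+ 2 * q ^+ 2 + q ^+ 4 = 239 /\
    4 * p ^+ 3 * q - 4 * p * q ^+ 3 = 1].
Proof.
have [x [y [x0 y0 h1 h2]]] := @complex_sqrt R 239 1 (ltr0n _ 239) ltr01.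
have [p [q [p0 q0 h3 h4]]] := complex_sqrt x0 y0.
exists p, q.
have xl : 154 / 10 < x by nra.
have yl : y < 325 / 10000 by nra.
have xu : x < 155 / 10 by nra.
have pl : 39 / 10 < p by nra.
have ql : q <= 5 / 1000 by nra.
have pu : p < 395 / 100 by nra.
split; [by rewrite q0 | lra | lra | clear -pl | split]; first by nra.
  transitivity ((p ^+ 2 - q ^+ 2) ^+ 2 - (2 * p * q) ^+ 2); first by ring.
  by rewrite h3 h4.
transitivity (2 * (p ^+ 2 - q ^+ 2) * (2 * p * q)); first by ring.
by rewrite h3 h4.
Qed.

Lemma cross_term_bound (R : realFieldType) (t : R) :
  120 * 171 * t <= 5 / 4 * 13 ^+ 4 -> 4 * t <= 7.
Proof. by move=> ?; lra. Qed.
Lemma imu_term_bound (R : realFieldType) (t : R) : t <= 1400 -> 5 / 1000 * t <= 7.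
Proof. by move=> ?; lra. Qed.

Lemma weighted_sum_le (R : realFieldType) (p q a b : R) : 0 < p -> 0 < q -> p + q <= 4 ->
  0 <= a -> 0 <= b -> p * a + q * b <= 4 * (a + b).
Proof.
move=> p0 q0 pq a0 b0; rewrite mulrDr; apply: lerD; apply: ler_wpM2r => //; lra.
Qed.

Section Large.
Variables (R : rcfType) (p q : R).
Hypotheses (p_gt0 : 0 < p) (q_gt0 : 0 < q) (q_le : q <= 5 / 1000) (q_lt_p : q < p)
  (pq_le : p + q <= 4) (norm_ge15 : 15 <= p ^+ 2 + q ^+ 2).
Hypotheses (Hre : p ^+ 4 - 6 * p ^+ 2 * q ^+ 2 + q ^+ 4 = 239)
  (Him : 4 * p ^+ 3 * q - 4 * p * q ^+ 3 = 1).
Variables (w1 w2 : int).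
Local Notation P := (p * w1%:~R - q * w2%:~R).
Local Notation Q := (p * w2%:~R + q * w1%:~R).
Hypotheses (QP : `|Q| <= `|P|) (hIm : `|4 * P ^+ 3 * Q - 4 * P * Q ^+ 3| <= 4 * 13 ^+ 4)
  (hRe : 0 < P ^+ 4 - 6 * P ^+ 2 * Q ^+ 2 + Q ^+ 4).
Local Notation e := (8 / 239 : R).

(** [hRe] and [QP] keep P + iQ within an angle pi/8 of the real axis, so 5 Q^2 <= P^2 and P^2 - Q^2
    >= (4/5) P^2 in [hIm]. *)
Lemma imag_small : `|Q| * `|P| ^+ 3 <= 5 / 4 * 13 ^+ 4.
Proof.
have hI : 4 * `|P| * `|Q| * (`|P| ^+ 2 - `|Q| ^+ 2) <= 4 * 13 ^+ 4.
  apply: le_trans hIm; rewrite (_ : 4 * P ^+ 3 * Q - _ = 4 * P * Q * (P ^+ 2 - Q ^+ 2)); last by ring.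
  rewrite !normrM normr_nat ler_wpM2l ?mulr_ge0 //.
  by rewrite !real_normK ?num_real // ler_norm.
have hR : 0 < `|P| ^+ 4 - 6 * `|P| ^+ 2 * `|Q| ^+ 2 + `|Q| ^+ 4.
  have e4 (x : R) : `|x| ^+ 4 = x ^+ 4 by rewrite -normrX ger0_norm // (exprM x 2 2) sqr_ge0.
  by rewrite !e4 !real_normK ?num_real.
move: (normr_ge0 P) (normr_ge0 Q) QP hI hR; move: `|P| `|Q| => a b a0 b0 ba hI hR.
have h : 5 * b ^+ 2 <= a ^+ 2.
  rewrite leNgt; apply/negP => h; have : 0 <= a ^+ 2 - b ^+ 2 by nra.
  have hR' : a ^+ 4 - 6 * a ^+ 2 * b ^+ 2 + b ^+ 4 =
    (a ^+ 2 - 5 * b ^+ 2) * (a ^+ 2 - b ^+ 2) - 4 * (b ^+ 2) ^+ 2 by ring.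
  rewrite {}hR' in hR.
  by move: (a ^+ 2) (b ^+ 2) h hR => A B h hR hAB; nra.
have hab : 0 <= a * b by rewrite mulr_ge0.
have h2 : 0 <= (a * b) * (a ^+ 2 - 5 * b ^+ 2) by rewrite mulr_ge0 // subr_ge0.
lra.
Qed.

(* P + i Q is u w for u = p + i q, and cross r is Im (N_r conj(w)) = Im (u N_r conj(u w)) / |u|^2. *)
Definition cross r : int := gim (appr r) * w1 - gre (appr r) * w2.

(** By [E] below, |u|^2 times this integer is a difference of two products. The hypotheses are tuned
    so that each is at most 7 in absolute value; as |u|^2 >= 15 > 7 + 7, the integer vanishes. *)
Lemma cross_eq0 r : e ^+ r * `|P| <= 1400 -> 120 * 171 * 7700 ^+ r <= `|P| ^+ 3 -> cross r = 0.
Proof.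
move=> h1 h2.
have hi := imu_bound q_gt0 Hre Him r q_lt_p.
have [hA hB] := @appr_growth 7700 r (lexx _).
have hA' : `|Aseq R r| <= 7700 ^+ r by rewrite -(ler_int R) intr_norm rmorphXn in hA.
have hB' : `|Bseq R r| <= 7700 ^+ r by rewrite -(ler_int R) intr_norm rmorphXn in hB.
pose reu := p * Aseq R r - q * Bseq R r.
have hr : `|reu| <= 4 * 7700 ^+ r.
  apply: le_trans (ler_normB _ _) _; rewrite !normrM (gtr0_norm q_gt0) (gtr0_norm p_gt0).
  apply: le_trans (lerD (ler_wpM2l (ltW p_gt0) hA') (ler_wpM2l (ltW q_gt0) hB')) _.
  by rewrite -mulrDl ler_wpM2r ?exprn_ge0.
have E : (p ^+ 2 + q ^+ 2) * (cross r)%:~R = imu p q r * P - reu * Q.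
  by rewrite /cross rmorphB !rmorphM /imu /reu /Aseq /Bseq /=; ring.
have : 15 * `|(cross r)%:~R : R| < 15.
  apply: (@le_lt_trans _ _ ((p ^+ 2 + q ^+ 2) * `|(cross r)%:~R : R|)); first by rewrite ler_wpM2r.
  have -> : (p ^+ 2 + q ^+ 2) * `|(cross r)%:~R : R| = `|(p ^+ 2 + q ^+ 2) * (cross r)%:~R|.
    by rewrite normrM ger0_norm // (le_trans _ norm_ge15).
  rewrite E; apply: le_lt_trans (ler_normB _ _) _; rewrite !normrM.
  have t1 : `|imu p q r| * `|P| <= 7.
    apply: le_trans (ler_wpM2r (normr_ge0 P) hi) _; rewrite -mulrA.
    apply: le_trans (ler_wpM2r _ q_le) _; last exact: imu_term_bound.
    by rewrite mulr_ge0 // exprn_ge0 // divr_ge0.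
  have t2 : `|reu| * `|Q| <= 7.
    apply: le_trans (ler_wpM2r (normr_ge0 Q) hr) _; rewrite -mulrA; apply: cross_term_bound.
    rewrite mulrA; apply: le_trans (ler_wpM2r (normr_ge0 Q) h2) _.
    by rewrite mulrC imag_small.
  by apply: le_lt_trans (lerD t1 t2) _; rewrite -natrD ltr_nat.
rewrite -[X in _ < X]mulr1 ltr_pM2l ?ltr0n // -intr_norm ltrz1.
by rewrite -[1]add0r ltzD1 normr_le0 => /eqP.
Qed.

(** Cubing the hypothesis compares 7700^k with e^(-3k), and 7700 e^3 < 289/1000. From k = 5 on, this
    margin absorbs the constant 120 * 171 * 7700^2 / 1400^3. *)
Lemma growth_threshold k (a : R) : (5 <= k)%N -> 1400 < e ^+ k * a ->
  120 * 171 * 7700 ^+ k.+2 <= a ^+ 3.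
Proof.
move=> k5 ha; have e0 : 0 < e by rewrite divr_gt0.
have ek0 : 0 < e ^+ k by rewrite exprn_gt0.
have h1 : 1400 ^+ 3 <= (e ^+ k * a) ^+ 3 by rewrite lerXn2r ?nnegrE //; lra.
have h2 : (7700 * e ^+ 3) ^+ k <= (289 / 1000) ^+ 5.
  apply: (@le_trans _ _ ((289 / 1000) ^+ k)).
    by apply: lerXn2r; rewrite ?nnegrE; [rewrite mulr_ge0 // exprn_ge0 // ltW | lra | lra].
  by apply: ler_wiXn2l => //; lra.
have E3 : 0 < (e ^+ k) ^+ 3 by rewrite exprn_gt0.
rewrite -(ler_pM2l E3) -exprMn; apply: le_trans h1.
rewrite (_ : _ * _ = 120 * 171 * 7700 ^+ 2 * (7700 * e ^+ 3) ^+ k).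
  apply: le_trans (ler_wpM2l _ h2) _; last by lra.
  by rewrite !mulr_ge0 ?exprn_ge0.
have gen (x y : R) : y ^+ k ^+ 3 * (120 * 171 * x ^+ k.+2) = 120 * 171 * x ^+ 2 * (x * y ^+ 3) ^+ k.
  by rewrite exprMn -!exprM -[k.+2]addn2 exprD (mulnC k); ring.
exact: gen.
Qed.

(** Take the least m with [e ^+ m * |P| <= 1400]. Failure at m - 1 yields, through
    [growth_threshold], the other hypothesis of [cross_eq0] at both m and m + 1; two linear forms
    with nonzero determinant then vanish at (w1, w2). *)
Lemma no_large : 1400 < e ^+ 5 * `|P| -> w1 = 0 /\ w2 = 0.
Proof.
move=> big.
have e0 : 0 < e by rewrite divr_gt0.
have ex : exists r, e ^+ r * `|P| <= 1400.
  (* Any [n] that is at least |P| works, since [n < 2 ^ n] and 2e <= 1. *)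
  pose n := (4 * (absz w1 + absz w2))%N; exists n.
  have Pn : `|P| <= n%:R.
    apply: le_trans (ler_normB _ _) _; rewrite !normrM (gtr0_norm p_gt0) (gtr0_norm q_gt0).
    rewrite -!intr_norm -!abszE -!pmulrn /n natrM natrD.
    exact: weighted_sum_le.
  have h1 : (e * 2) ^+ n <= 1 by apply: exprn_ile1; lra.
  apply: le_trans (ler_wpM2l _ Pn) _; first by rewrite exprn_ge0 // ltW.
  apply: (@le_trans _ _ (e ^+ n * 2 ^+ n)).
    by rewrite ler_wpM2l ?exprn_ge0 ?(ltW e0) // -natrX ler_nat ltnW // ltn_expl.
  by rewrite -exprMn; apply: le_trans h1 _; rewrite ler1n.
case: (ex_minnP ex) => m hm mmin.
have m5 : (5 < m)%N.
  rewrite ltnNge; apply/negP => m5; suff : 1400 < e ^+ m * `|P| by rewrite ltNge hm.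
  apply: lt_le_trans big _; apply: ler_wpM2r => //.
  by apply: ler_wiXn2l => //; lra.
case: m m5 hm mmin => // m m5 hm mmin.
have hm' : 1400 < e ^+ m * `|P|.
  by rewrite ltNge; apply/negP => /mmin; rewrite ltnn.
have T := growth_threshold m5 hm'.
have c1 : cross m.+1 = 0.
  apply: cross_eq0 => //; apply: le_trans T; rewrite ler_wpM2l ?mulr_ge0 //.
  by rewrite (exprS _ m.+1) ler_peMl ?exprn_ge0 // ler1n.
have c2 : cross m.+2 = 0.
  apply: cross_eq0 => //; apply: le_trans hm; apply: ler_wpM2r => //.
  by apply: ler_wiXn2l => //; lra.
have := appr_indep m.+1; move: c1 c2; rewrite /cross.
move: (gre (appr m.+2)) (gre (appr m.+1)) (gim (appr m.+2)) (gim (appr m.+1)).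
move=> a2 a1 b2 b1 /eqP; rewrite subr_eq0 => /eqP h1 /eqP; rewrite subr_eq0 => /eqP h2 D0.
split; apply: (mulfI D0); rewrite mulr0.
  transitivity (a2 * (b1 * w1) - a1 * (b2 * w1)); first by ring.
  by rewrite h1 h2; ring.
transitivity (b1 * (a2 * w2) - b2 * (a1 * w2)); first by ring.
by rewrite -h1 -h2; ring.
Qed.
End Large.

(** This converts (-1+i) g^4 into (239+i) (g (3+2i))^4, up to the factor 13^4. *)
Lemma base_approximation : Gint 239 1 * Gint 3 2 ^+ 4 = gofint (13 ^+ 4) * Gint (-1) 1.
Proof.
have e2 : Gint 3 2 ^+ 2 = Gint 5 12 by apply: gintP.
have e4 : Gint 3 2 ^+ 4 = Gint (- 119) 120 by rewrite (exprM _ 2 2) e2; apply: gintP.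
by rewrite e4; apply: gintP => /=; ring.
Qed.

Lemma gint_pow4 (w : gint) : w ^+ 4 =
  Gint (gre w ^+ 4 - 6 * gre w ^+ 2 * gim w ^+ 2 + gim w ^+ 4)
       (4 * gre w ^+ 3 * gim w - 4 * gre w * gim w ^+ 3).
Proof.
by rewrite (exprM w 2 2) expr2 expr2; apply: gintP; rewrite !(greM, gimM) /=; ring.
Qed.

(** The hypotheses give a^2 >= 97 * 5^30, and (8/239)^2 * 5^6 >= 17 while 97 * 17^5 > 1400^2. *)
Lemma large_enough (R : realFieldType) (a n : R) : 0 <= a -> 5 ^+ 30 <= n -> 15 * (13 * n) <= 2 * a ^+ 2 ->
  1400 < (8 / 239) ^+ 5 * a.
Proof.
move=> a0 hn h; have e0 : 0 <= 8 / 239 :> R by rewrite divr_ge0.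
rewrite ltNge; apply/negP => h1.
have : ((8 / 239) ^+ 5 * a) ^+ 2 <= 1400 ^+ 2.
  apply: lerXn2r => //; rewrite nnegrE; last exact: ler0n.
  by rewrite mulr_ge0 // exprn_ge0.
apply/negP; rewrite -ltNge.
apply: (@lt_le_trans _ _ (97 * 17 ^+ 5)); first by lra.
apply: (@le_trans _ _ (97 * ((8 / 239) ^+ 2 * 5 ^+ 6) ^+ 5)).
  rewrite ler_wpM2l //; apply: lerXn2r; rewrite ?nnegrE; [lra| |lra].
  by rewrite mulr_ge0 // exprn_ge0.
have -> : 97 * ((8 / 239) ^+ 2 * 5 ^+ 6) ^+ 5 = ((8 / 239 : R) ^+ 5) ^+ 2 * (97 * 5 ^+ 30).
  by rewrite exprMn -!exprM; ring.
rewrite [(_ * a) ^+ 2]exprMn; apply: ler_wpM2l; first by rewrite sqr_ge0.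
have : 0 <= 5 ^+ 30 :> R by rewrite exprn_ge0.
by move: (5 ^+ 30) hn (a ^+ 2) h => t hn A h t0; lra.
Qed.

(** With w = g (3+2i), the number (u w)^4 = 13^4 c (X + it) has positive real part and imaginary
    part at most 4 * 13^4 in absolute value; if g had large norm, [no_large] would give w = 0. *)
Lemma thue_gnorm_lt (g : gint) (c X t : int) :
  Gint (-1) 1 * g ^+ 4 = gofint c * Gint X t -> 0 < X -> 0 < c <= 4 -> t = 1 \/ t = -1 ->
  gnorm g < 5 ^+ 30.
Proof.
move=> E X0 /andP[c0 c4] ht; rewrite ltNge; apply/negP => big.
have [p [q [/andP[q0 qle] qp pq s15 [Hre Him]]]] := fourth_root_exists realalg.
have p0 := lt_trans q0 qp.
pose Q z := p * (gim (z * Gint 3 2))%:~R + q * (gre (z * Gint 3 2))%:~R.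
pose P z := p * (gre (z * Gint 3 2))%:~R - q * (gim (z * Gint 3 2))%:~R.
(* Multiplying [g] by i preserves [g ^+ 4] and swaps |P| and |Q|. *)
wlog hQ : g E big / `|Q g| <= `|P g|.
  move=> H; have [hQ|/ltW hQ] := leP `|Q g| `|P g|; first exact: H hQ.
  apply: (H (gi * g)).
  - by rewrite exprMn gi4 mul1r.
  - by rewrite gnormM {1}/gnorm /= !expr2 mul0r add0r !mul1r.
  have e1 : gre (gi * g * Gint 3 2) = - gim (g * Gint 3 2) by rewrite /=; ring.
  have e2 : gim (gi * g * Gint 3 2) = gre (g * Gint 3 2) by rewrite /=; ring.
  by rewrite /Q /P e1 e2 rmorphN /= !mulrN -opprD normrN.
rewrite /Q /P in hQ.
set w := g * Gint 3 2 in hQ *.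
have Ew : Gint 239 1 * w ^+ 4 = gofint (13 ^+ 4 * c) * Gint X t.
  transitivity (gofint (13 ^+ 4) * (gofint c * Gint X t)); last by rewrite mulrA -rmorphM.
  by rewrite exprMn mulrCA base_approximation mulrCA -E [g ^+ 4 * _]mulrC.
have [F G] : 239 * (gre w ^+ 4 - 6 * gre w ^+ 2 * gim w ^+ 2 + gim w ^+ 4)
    - (4 * gre w ^+ 3 * gim w - 4 * gre w * gim w ^+ 3) = 13 ^+ 4 * c * X /\
  239 * (4 * gre w ^+ 3 * gim w - 4 * gre w * gim w ^+ 3)
    + (gre w ^+ 4 - 6 * gre w ^+ 2 * gim w ^+ 2 + gim w ^+ 4) = 13 ^+ 4 * c * t.
  have := congr1 gre Ew; have := congr1 gim Ew.
  rewrite gint_pow4 gre_scale gim_scale greM gimM /= !mul1r => <- <-; split; ring.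
have nw : gnorm w = 13 * gnorm g by rewrite gnormM mulrC.
move: w hQ F G nw {Ew} => [w1 w2] /= hQ F G nw.
have NR := congr1 (fun z : int => z%:~R : realalg) nw.
have bR : 5 ^+ 30 <= (gnorm g)%:~R :> realalg by rewrite -(ler_int realalg) rmorphXn in big.
have [z1 z2] : w1 = 0 /\ w2 = 0.
  apply: (no_large p0 q0 qle qp pq s15 Hre Him hQ).
  - have -> : 4 * (p * w1%:~R - q * w2%:~R) ^+ 3 * (p * w2%:~R + q * w1%:~R) -
       4 * (p * w1%:~R - q * w2%:~R) * (p * w2%:~R + q * w1%:~R) ^+ 3 = (13 ^+ 4 * c * t)%:~R.
      rewrite -G; transitivity ((p ^+ 4 - 6 * p ^+ 2 * q ^+ 2 + q ^+ 4) *
         (4 * w1%:~R ^+ 3 * w2%:~R - 4 * w1%:~R * w2%:~R ^+ 3) +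
         (4 * p ^+ 3 * q - 4 * p * q ^+ 3) *
         (w1%:~R ^+ 4 - 6 * w1%:~R ^+ 2 * w2%:~R ^+ 2 + w2%:~R ^+ 4)); first by ring.
      by rewrite Hre Him; ring.
    have hD : `|13 ^+ 4 * c * t| <= 4 * 13 ^+ 4.
      have -> : `|13 ^+ 4 * c * t| = 13 ^+ 4 * c.
        rewrite normrM (_ : `|t| = 1) ?mulr1; last by case: ht => ->.
        by rewrite ger0_norm // mulr_ge0 ?exprn_ge0 // ltW.
      by rewrite mulrC ler_wpM2r // exprn_ge0.
    rewrite -intr_norm; rewrite -(ler_int realalg) in hD; apply: le_trans hD _.
    by rewrite le_eqVlt; apply/orP; left; apply/eqP; ring.
  - have -> : (p * w1%:~R - q * w2%:~R) ^+ 4 - 6 * (p * w1%:~R - q * w2%:~R) ^+ 2 *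
       (p * w2%:~R + q * w1%:~R) ^+ 2 + (p * w2%:~R + q * w1%:~R) ^+ 4 = (13 ^+ 4 * c * X)%:~R.
      rewrite -F; transitivity ((p ^+ 4 - 6 * p ^+ 2 * q ^+ 2 + q ^+ 4) *
         (w1%:~R ^+ 4 - 6 * w1%:~R ^+ 2 * w2%:~R ^+ 2 + w2%:~R ^+ 4) -
         (4 * p ^+ 3 * q - 4 * p * q ^+ 3) *
         (4 * w1%:~R ^+ 3 * w2%:~R - 4 * w1%:~R * w2%:~R ^+ 3)); first by ring.
      by rewrite Hre Him; ring.
    by rewrite ltr0z !mulr_gt0 // exprn_gt0.
  apply: (large_enough _ bR) => //.
  have hPQ : (p * w2%:~R + q * w1%:~R) ^+ 2 <= `|p * w1%:~R - q * w2%:~R| ^+ 2.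
    by rewrite -real_normK ?num_real //; apply: lerXn2r; rewrite ?nnegrE.
  apply: (@le_trans _ _ ((p ^+ 2 + q ^+ 2) * (13 * (gnorm g)%:~R))).
    by apply: ler_wpM2r => //; rewrite mulr_ge0 // (le_trans _ bR) ?exprn_ge0.
  have -> : 13 * (gnorm g)%:~R = w1%:~R ^+ 2 + w2%:~R ^+ 2 :> realalg.
    by move: NR; rewrite /gnorm /= rmorphM rmorphD !rmorphXn /= => <-.
  apply: (@le_trans _ _ ((p * w1%:~R - q * w2%:~R) ^+ 2 + (p * w2%:~R + q * w1%:~R) ^+ 2)).
    by rewrite le_eqVlt; apply/orP; left; apply/eqP; ring.
  rewrite mulr_natl mulr2n; apply: lerD => //.
  by rewrite real_normK ?num_real.
have : 0 < gnorm g by apply: lt_le_trans big; rewrite exprn_gt0.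
have : 13 * gnorm g == 0 by rewrite -nw z1 z2.
by rewrite mulf_eq0 /= => /eqP ->; rewrite ltxx.
Qed.

(** The source is (-1+i)((x+1) + ix) = -(2x+1) + i. An odd power of i exchanges the coordinates, and
    conjugating [d] exchanges them back up to sign. *)
Lemma gint_quartic_of_consecutive (x y : int) : x ^+ 2 + (x + 1) ^+ 2 = y ^+ 4 ->
  exists (g : gint) (X t : int), [/\ Gint (-1) 1 * g ^+ 4 = Gint X t, X = 2 * x + 1 \/ X = - (2 * x + 1),
    t = 1 \/ t = -1 & gnorm g = `|y|].
Proof.
move=> E; have [j [d [j4 hd]]] := consecutive_squares_expn E.
have nd : gnorm d = `|y|.
  apply/eqP; rewrite -(@eqrXn2 _ 4) ?gnorm_ge0 // -normrX ger0_norm; last first.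
    by rewrite (exprM y 2 2) sqr_ge0.
  have : gnorm (Gint (x + 1) x) = gnorm d ^+ 4 by rewrite hd gnormM !gnormX expr1n mul1r.
  by rewrite -E /gnorm /= addrC => ->.
have hd' : gi ^+ j * (Gint (-1) 1 * d ^+ 4) = Gint (- (2 * x + 1)) 1.
  by rewrite mulrCA -hd; apply: gintP; rewrite /=; ring.
have inv k : (k <= 4)%N -> gi ^+ (4 - k) * gi ^+ k = 1.
  by move=> k4; rewrite -exprD subnK // gi4.
have hd2 : Gint (-1) 1 * d ^+ 4 = gi ^+ (4 - j) * Gint (- (2 * x + 1)) 1.
  by rewrite -hd' mulrA inv ?mul1r // ltnW.
have conj4 (X t : int) : Gint (-1) 1 * d ^+ 4 = Gint X t ->
    Gint (-1) 1 * gconj d ^+ 4 = Gint (- t) (- X).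
  move=> h; have : gconj (Gint (-1) 1 * d ^+ 4) * (- gi) = Gint (- t) (- X).
    by rewrite h; apply: gintP; rewrite /=; ring.
  have e : gconj (Gint (-1) 1) * (- gi) = Gint (-1) 1 by apply: gintP.
  by move=> <-; rewrite rmorphM rmorphXn mulrAC [X in _ = X * _]e.
have nc : gnorm (gconj d) = `|y| by rewrite -nd /gnorm /= sqrrN.
case: j j4 hd2 {hd hd'} => [|[|[|[|j]]]] // _ hd2.
- exists d, (- (2 * x + 1)), 1; split; [|by right|by left|done].
  by rewrite hd2; apply: gintP; rewrite /=; ring.
- exists (gconj d), (- (2 * x + 1)), (-1); split; [|by right|by right|done].
  by apply: conj4; rewrite hd2; apply: gintP; rewrite /=; ring.
- exists d, (2 * x + 1), (-1); split; [|by left|by right|done].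
  by rewrite hd2; apply: gintP; rewrite /=; ring.
exists (gconj d), (2 * x + 1), 1; split; [|by left|by left|done].
by rewrite (@conj4 (-1) (- (2 * x + 1))) ?opprK // hd2; apply: gintP; rewrite /=; ring.
Qed.

Lemma quartic_bound (x y : int) : x ^+ 2 + (x + 1) ^+ 2 = y ^+ 4 -> `|y| < 5 ^+ 30.
Proof.
move=> /gint_quartic_of_consecutive[g [X [t [h hX ht <-]]]].
have X0 : X != 0 by case: hX => ->; lia.
case: (ltrgtP X 0) X0 => // X0 _.
  (* (1+i)^4 = -4 turns a negative X into a positive one. *)
  have h4 : Gint (-1) 1 * (gi1 * g) ^+ 4 = gofint 4 * Gint (- X) (- t).
    rewrite exprMn mulrCA h (_ : gi1 ^+ 4 = gofint (-4)); last exact: gintP.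
    by apply: gintP; rewrite /=; ring.
  have := thue_gnorm_lt h4; rewrite oppr_gt0 => /(_ X0 isT) h5.
  apply: le_lt_trans (h5 _); last by case: ht => ->; [right | left].
  by rewrite gnormM ler_peMl ?gnorm_ge0.
apply: (@thue_gnorm_lt g 1 X t) => //; rewrite h.
by apply: gintP; rewrite /=; ring.
Qed.

(** * Pell numbers and Ljunggren's equation *)

Fixpoint pell n : nat * nat :=
  if n is n'.+1 then let: (a, b) := pell n' in (3 * a + 4 * b, 2 * a + 3 * b)%N else (1, 1)%N.

(** Descent: dividing X + Z sqrt(2) by the unit 3 + 2 sqrt(2) gives a smaller positive solution as
    long as Z > 1. *)
Lemma pell_complete X Z : (0 < X)%N -> (X * X + 1 = 2 * (Z * Z))%N -> exists n, (X, Z) = pell n.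
Proof.
have [m] := ubnP Z; elim: m X Z => // m IH X Z Zm X0 h.
have [Z1|Z1] := leqP Z 1.
  exists 0%N; have : Z = 1%N by case: Z Z1 h {Zm} => [|[|]] //; nia.
  by move=> EZ; rewrite EZ in h *; have -> : X = 1%N by nia.
have Z3 : (2 < Z)%N by rewrite ltn_neqAle Z1 andbT; apply/eqP => EZ; rewrite -EZ in h; have [X2|X2] := leqP X 2; nia.
have hl : (4 * Z < 3 * X)%N by nia.
have hu : (2 * X < 3 * Z)%N by nia.
have hlt : (Z < X)%N by nia.
have [|||n hn] := IH (3 * X - 4 * Z)%N (3 * Z - 2 * X)%N; [lia|lia| |].
  have e1 : ((3 * X - 4 * Z) + 4 * Z = 3 * X)%N by lia.
  have e2 : ((3 * Z - 2 * X) + 2 * X = 3 * Z)%N by lia.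
  move: (3 * X - 4 * Z)%N (3 * Z - 2 * X)%N e1 e2 => a b e1 e2; nia.
by exists n.+1; rewrite /= -hn; congr (_, _); lia.
Qed.

Lemma pell_ge n : (5 ^ n <= (pell n).2 <= (pell n).1)%N.
Proof.
elim: n => //= n; case: (pell n) => a b /= /andP[h1 h2]; rewrite expnS; lia.
Qed.

Fixpoint pellmod m n : nat * nat :=
  if n is n'.+1 then let: (a, b) := pellmod m n' in
    ((3 * a + 4 * b) %% m, (2 * a + 3 * b) %% m)%N else (1 %% m, 1 %% m)%N.

Lemma pellmodE m n : pellmod m n = ((pell n).1 %% m, (pell n).2 %% m)%N.
Proof.
elim: n => //= n ->; case: (pell n) => a b /=; congr (_, _);
by rewrite -modnDm modnMmr modnMmr modnDm.
Qed.

Definition nonsquare_mod (m z : nat) := all (fun t : nat => (t * t) %% m != z)%N (iota 0 m).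

Lemma nonsquare_modP (m z y : nat) : (0 < m)%N -> nonsquare_mod m (z %% m) -> z <> (y * y)%N.
Proof.
move=> m0 /allP h E; have := h (y %% m)%N; rewrite mem_iota ltn_mod m0 => /(_ isT).
by rewrite modnMm E eqxx.
Qed.

(* The moduli were found by search; together they rule out every other index below 60. *)
Lemma pell_square_small n Y : (n < 60)%N -> (pell n).2 = (Y * Y)%N -> n = 0%N \/ n = 3%N.
Proof.
move=> n60 E.
have : all (fun n => [|| n == 0, n == 3 |
    has (fun m => (0 < m) && nonsquare_mod m (pellmod m n).2) [:: 3; 7; 13; 19; 23; 31; 37]])%N
    (iota 0 60) by vm_compute.
move/allP => /(_ n); rewrite mem_iota => /(_ n60) /or3P[/eqP|/eqP|]; [by left|by right|].
case/hasP => m _ /andP[m0]; rewrite pellmodE /= => /(nonsquare_modP m0).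
by move=> /(_ Y); rewrite E.
Qed.

Theorem ljunggren (x y : int) : x ^+ 2 + (x + 1) ^+ 2 = y ^+ 4 ->
  [\/ x = 0, x = -1, x = 119 | x = -120].
Proof.
move=> E; have Ey := quartic_bound E.
pose A := absz (2 * x + 1); pose B := absz y.
have hX : (A * A + 1 = 2 * ((B * B) * (B * B)))%N.
  apply/eqP; rewrite -eqz_nat !PoszD !PoszM /A /B !abszE; apply/eqP.
  have sq (a : int) : `|a| * `|a| = a ^+ 2 :> int by rewrite -expr2 real_normK ?num_real.
  rewrite !sq -expr2 -exprM -E; ring.
have [|n hn] := pell_complete _ hX; first by rewrite absz_gt0; lia.
(* [pell_ge] and [quartic_bound] give 5^n <= B^2 < 5^60. *)
have n60 : (n < 60)%N.
  have Ey' : (B < 5 ^ 30)%N by rewrite -ltz_nat abszE -[Posz (5 ^ 30)]natz natrX.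
  have /andP[h _] := pell_ge n; rewrite -hn /= in h.
  rewrite -(ltn_exp2l _ _ (isT : 1 < 5)%N); apply: leq_ltn_trans h _.
  by rewrite -[60%N]/(30 + 30)%N expnD ltn_mul.
have [|n0|n3] := @pell_square_small n B n60; first by rewrite -hn.
  have [->|->] : x = 0 \/ x = -1 by move: hn; rewrite n0 /A => -[h _]; lia.
    by constructor 1.
  by constructor 2.
have [->|->] : x = 119 \/ x = -120 by move: hn; rewrite n3 /A => -[h _]; lia.
  by constructor 3.
by constructor 4.
Qed.

(** * Reduction to exponent two *)

(** The root is [gcdn a c]: at each prime dividing [a] the valuation of [b] is zero, so that of [a]
    is n+1 times that of [c]. *)
Lemma coprime_mul_expn (a b c n : nat) : (0 < a)%N -> (0 < b)%N -> coprime a b ->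
  (a * b = c ^ n.+1)%N -> exists d, (a = d ^ n.+1)%N.
Proof.
move=> a0 b0 cop E; exists (gcdn a c).
have c0 : (0 < c)%N by move: (muln_gt0 a b); rewrite a0 b0 E expn_gt0 /= orbF.
apply: eqn_from_log; rewrite ?expn_gt0 ?gcdn_gt0 ?a0 // => p.
rewrite lognX logn_gcd //.
have := logn_gcd p a0 b0; rewrite (eqP cop) logn1.
have := congr1 (logn p) E; rewrite lognM // lognX.
move: (logn p a) (logn p b) (logn p c) => u v w h1 h2.
have [u0|u0] := posnP u; first by rewrite u0 min0n muln0.
have v0 : v = 0%N by lia.
rewrite v0 addn0 in h1; rewrite h1; congr (_ * _)%N.
by apply/esym/minn_idPr; rewrite leq_pmull.
Qed.

(** Otherwise t = v/u satisfies t^2 = -1 modulo p; as (p-1)/2 is odd, Fermat gives t = t^p = -t,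
    which is impossible. *)
Lemma prime_3mod4_dvd (p u v : nat) : prime p -> (p %% 4 = 3)%N ->
  (p %| u * u + v * v)%N -> (p %| u)%N.
Proof.
move=> pp p4 hd.
have ch : p \in [pchar 'F_p] by apply: pchar_Fp.
have h0 : (u%:R : 'F_p) ^+ 2 + v%:R ^+ 2 = 0.
  by apply/eqP; rewrite !expr2 -!natrM -natrD -(dvdn_pcharf ch).
apply: contraT => pu.
have u0 : (u%:R : 'F_p) != 0 by rewrite -(dvdn_pcharf ch).
pose t : 'F_p := v%:R / u%:R.
have t2 : t ^+ 2 = -1.
  apply: (mulIf (expf_neq0 2 u0)); rewrite mulN1r -exprMn divfK //.
  by apply/eqP; rewrite -addr_eq0 addrC h0.
have tp : t ^+ p = t by have := expf_card t; rewrite card_Fp.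
have Ep : (p = 2 * (2 * (p %/ 4) + 1) + 1)%N by have := divn_eq p 4; rewrite p4; lia.
have t1 : t != 0 by apply: contra_eq_neq t2 => ->; rewrite expr0n eq_sym oppr_eq0 oner_eq0.
have : (2%:R : 'F_p) == 0.
  have : t ^+ (2 * (2 * (p %/ 4)%N + 1) + 1)%N = t by rewrite -Ep.
  rewrite exprD expr1 exprM t2 exprD exprM sqrrN !expr1n mul1r.
  rewrite ?expr1 mulN1r => h; have /eqP : 2%:R * t = 0.
    by rewrite mulr_natl mulr2n -{1}h addNr.
  by rewrite mulf_eq0 => /orP[//|]; rewrite (negPf t1).
rewrite -(dvdn_pcharf ch) => /(dvdn_leq (isT : 0 < 2)%N) p2.
have p_eq2 : p = 2%N by apply/eqP; rewrite eqn_leq p2 prime_gt1.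
by move: p4; rewrite p_eq2.
Qed.

Lemma consecutive_squares_gt0 (x : int) : 0 < x ^+ 2 + (x + 1) ^+ 2.
Proof. nia. Qed.

(** A common prime p divides m x^(2(m-1)) because -(x+1)^2 = x^2 modulo [s]. It does not divide x,
    since it would then divide x + 1; so p divides m, against [prime_3mod4_dvd]. *)
Lemma consecutive_cofactor_coprime (m : nat) (x : int) :
  (forall p : nat, prime p -> (p %| m)%N -> (p %% 4 = 3)%N) ->
  coprime (absz (x ^+ 2 + (x + 1) ^+ 2))
    (absz (\sum_(i < m) (x ^+ 2) ^+ (m.-1 - i) * (- (x + 1) ^+ 2) ^+ i)).
Proof.
move=> hm; set s := x ^+ 2 + _; set Q := \sum_(i < m) _.
have s0 : s != 0 by rewrite gt_eqF // consecutive_squares_gt0.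
apply/negPn/negP => /negPf ncop.
have g1 : (1 < gcdn `|s| `|Q|)%N.
  by rewrite ltn_neqAle eq_sym -/(coprime _ _) ncop gcdn_gt0 absz_gt0 s0.
have pp := pdiv_prime g1; set p := pdiv _ in pp.
have := pdiv_dvd (gcdn `|s| `|Q|); rewrite dvdn_gcd -/p => /andP[ps pQ].
have sQ : (s %| Q - m%:Z * (x ^+ 2) ^+ m.-1)%Z.
  have -> : m%:Z * (x ^+ 2) ^+ m.-1 = \sum_(i < m) (x ^+ 2) ^+ m.-1.
    by rewrite sumr_const card_ord -mulr_natl natz.
  rewrite /Q -sumrB; apply: rpred_sum => i _.
  have -> : (x ^+ 2) ^+ m.-1 = (x ^+ 2) ^+ (m.-1 - i) * (x ^+ 2) ^+ i.
    by rewrite -exprD subnK // -ltnS (ltn_predK (ltn_ord i)).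
  rewrite -mulrBr subrXX; apply: dvdz_mull; apply: dvdz_mulr.
  have -> : - (x + 1) ^+ 2 - x ^+ 2 = - s by rewrite /s; ring.
  by rewrite rpredN.
have pm : (p %| m * absz x ^ (2 * m.-1))%N.
  have : (p%:Z %| m%:Z * (x ^+ 2) ^+ m.-1)%Z.
    rewrite -[_ * _](subKr Q) rpredB //; apply: dvdz_trans sQ; exact: ps.
  by rewrite dvdzE abszM -exprM abszX.
pose x1 := absz (x + 1).
have px1 : (p %| absz x)%N -> (p %| x1)%N.
  move=> px; have : (p%:Z %| (x + 1) ^+ 2)%Z.
    have -> : (x + 1) ^+ 2 = s - x ^+ 2 by rewrite /s; ring.
    by rewrite rpredB //; apply: dvdz_mulr.
  by rewrite dvdzE abszX Euclid_dvdX // => /andP[].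
have npx : ~~ (p %| absz x)%N.
  apply/negP => px; have : (p%:Z %| x + 1 - x)%Z by apply: rpredB; [exact: px1 | exact: px].
  by rewrite addrAC subrr add0r dvdzE dvdn1 /= => /eqP p1; move: pp; rewrite p1.
move: pm; rewrite Euclid_dvdM // Euclid_dvdX // (negbTE npx) /= orbF => pm.
move/negP: npx; apply; apply: (@prime_3mod4_dvd p _ (absz (x + 1))) => //; first exact: hm.
suff -> : (absz x * absz x + absz (x + 1)%R * absz (x + 1)%R = absz s)%N by exact: ps.
apply/eqP; rewrite -eqz_nat PoszD !PoszM !abszE -!expr2 !real_normK ?num_real //.
by rewrite ger0_norm // /s addr_ge0 ?sqr_ge0.
Qed.

Lemma consecutive_squares_power (x y : int) n : (2 < n)%N -> x ^+ 2 + (x + 1) ^+ 2 = y ^+ n ->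
  x = 0 \/ x = -1 \/ (x = 119 \/ x = -120) /\ n = 4%N.
Proof.
move=> n3 E.
(* Here y^(4t) = 13^4, so |y|^t = 13, and the 13-adic valuation forces t = 1. *)
have pick13 : x = 119 \/ x = -120 -> forall t : nat, n = (4 * t)%N -> t = 1%N.
  move=> hx t nt; have t0 : (0 < t)%N by case: t nt => // nt; rewrite nt in n3.
  have e13 : x ^+ 2 + (x + 1) ^+ 2 = 13 ^+ 4 by case: hx => ->; ring.
  have : (absz y ^ t = 13)%N.
    have h4 : ((absz y ^ t) ^ 4 = 13 ^ 4)%N.
      by rewrite -expnM mulnC -nt -abszX -E e13 abszX.
    by apply/eqP; rewrite -(eqn_exp2r _ _ (isT : 0 < 4)%N) h4.
  move/(congr1 (logn 13)); rewrite lognX => /eqP.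
  by rewrite (_ : logn 13 13 = 1)%N // muln_eq1 => /andP[/eqP].
have En := divn_eq n 4.
have [on|en] := boolP (odd n).
  by case: (stormer on _ E) => [|->|->]; [lia|left|right; left].
have : (n %% 4 = 0 \/ n %% 4 = 2)%N by lia.
case=> n4; rewrite n4 in En; last first.
  (* For n = 2 modulo 4, Stormer's theorem applies to [y ^+ 2] with the odd exponent n/2 >= 3. *)
  have E2 : x ^+ 2 + (x + 1) ^+ 2 = (y ^+ 2) ^+ (2 * (n %/ 4) + 1)%N.
    by rewrite E -exprM; congr (_ ^+ _); rewrite {1}En; lia.
  have [||->|->] := stormer _ _ E2; [by rewrite oddD oddM | by lia | by left | by right; left].
rewrite addn0 mulnC in En.
have E4 : x ^+ 2 + (x + 1) ^+ 2 = (y ^+ (n %/ 4)%N) ^+ 4 by rewrite E -exprM mulnC -En.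
have [->|->|hx|hx] := ljunggren E4; [by left|by right; left| |].
  by right; right; split; [left|rewrite En (pick13 _ _ En) //; left].
by right; right; split; [right|rewrite En (pick13 _ _ En) //; right].
Qed.

Lemma sum_pow_reduction (m n : nat) (x y : int) : odd m -> (0 < n)%N ->
  (forall p : nat, prime p -> (p %| m)%N -> (p %% 4 = 3)%N) ->
  x ^+ (2 * m) + (x + 1) ^+ (2 * m) = y ^+ n ->
  exists z : int, x ^+ 2 + (x + 1) ^+ 2 = z ^+ n.
Proof.
move=> om n0 hm E; have cop := consecutive_cofactor_coprime x hm.
set Q := \sum_(i < m) _ in cop.
set s := x ^+ 2 + _ in cop *.
have EQ : s * Q = y ^+ n.
  (* As [m] is odd, x^(2m) + (x+1)^(2m) is the difference of the m-th powers of x^2 and -(x+1)^2. *)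
  have := subrXX (x ^+ 2) (- (x + 1) ^+ 2) m; rewrite -/Q opprK -/s => <-.
  have -> : (- (x + 1) ^+ 2) ^+ m = - (x + 1) ^+ 2 ^+ m by rewrite exprNn -signr_odd om expr1 mulN1r.
  by rewrite opprK -!exprM E.
have s0 : 0 < s := consecutive_squares_gt0 x.
have y0 : 0 < y ^+ n.
  rewrite -E; have h (a : int) : 0 <= a ^+ (2 * m) by rewrite exprM exprn_ge0 ?sqr_ge0.
  have [->|x0] := eqVneq x 0; first by rewrite add0r expr1n ltr_wpDl.
  by rewrite ltr_wpDr // lt_def h expf_neq0.
have Q0 : 0 < Q by rewrite -(pmulr_rgt0 _ s0) EQ.
have En : (absz s * absz Q = absz y ^ n.-1.+1)%N by rewrite -abszM EQ abszX prednK.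
have [|| d hd] := coprime_mul_expn _ _ cop En; [by rewrite absz_gt0 gt_eqF..|].
exists d%:Z; rewrite -[LHS]gtz0_abs // hd prednK //.
by rewrite -[LHS]natz natrX natz.
Qed.

(** * The exceptional pair 119, 120 for larger exponents *)

Lemma pow_289_gt m : (1 < m)%N -> (7 ^ (2 * m) + 2 * 120 ^ m < 17 ^ (2 * m))%N.
Proof.
rewrite !expnM; elim: m => // -[//|[_ _|m IH _]]; first by vm_compute.
have := IH isT; rewrite !(expnS _ m.+2).
by move: ((7 ^ 2) ^ m.+2)%N (120 ^ m.+2)%N ((17 ^ 2) ^ m.+2)%N => a b c; lia.
Qed.

Lemma pow_119_gt m : (0 < m)%N -> (1 + 2 * 120 ^ m < 119 ^ (2 * m))%N.
Proof.
rewrite expnM; elim: m => // -[_ _|m IH _]; first by vm_compute.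
have := IH isT; rewrite !(expnS _ m.+1).
by move: (120 ^ m.+1)%N ((119 ^ 2) ^ m.+1)%N => a b; lia.
Qed.

(** The coprime factors Y^2 - 120^m and Y^2 + 120^m of 119^(2m) are 2m-th powers of c < d with cd =
    119. Their difference 2 * 120^m is too small for (1, 119), and for (7, 17) unless m = 1, where
    289 - 49 = 240. *)
Lemma pow_119_120_quartic (m Y : nat) : (0 < m)%N ->
  (119 ^ (2 * m) + 120 ^ (2 * m) = Y ^ 4)%N -> m = 1%N.
Proof.
move=> m0 E; pose W := (Y ^ 2)%N.
have EW : (119 ^ (2 * m) + 120 ^ m * 120 ^ m = W * W)%N.
  by rewrite -expnD addnn -mul2n E /W -expnD.
have lt0 : (0 < 119 ^ (2 * m))%N by rewrite expn_gt0.
have hW : (120 ^ m < W)%N by rewrite ltnNge; apply/negP => h; have := leq_mul h h; lia.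
pose A := (W - 120 ^ m)%N; pose B := (W + 120 ^ m)%N.
have AB : (A * B = 119 ^ (2 * m))%N.
  by rewrite /A /B mulnC mulnBr !mulnDl; lia.
have A0 : (0 < A)%N by rewrite subn_gt0.
have B0 : (0 < B)%N by rewrite /B addn_gt0 (leq_trans _ hW).
have EBA : (B = A + 2 * 120 ^ m)%N by rewrite /A /B; lia.
have cop : coprime A B.
  apply/negPn/negP => ncop.
  have g1 : (1 < gcdn A B)%N by rewrite ltn_neqAle eq_sym ncop gcdn_gt0 A0.
  have pp := pdiv_prime g1; have := pdiv_dvd (gcdn A B).
  rewrite dvdn_gcd => /andP[pA pB]; move: pp pA pB; set p := pdiv _ => pp pA pB.
  have p119 : (p %| 119)%N.
    have : (p %| 119 ^ (2 * m))%N by rewrite -AB dvdn_mulr.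
    by rewrite Euclid_dvdX // => /andP[].
  have p240 : (p %| 2 * 120)%N.
    have : (p %| 2 * 120 ^ m)%N by rewrite -(dvdn_addr _ pA) -EBA.
    by rewrite !Euclid_dvdM // Euclid_dvdX // => /orP[->//|/andP[-> _]]; rewrite orbT.
  have : (p %| gcdn 119 240)%N by rewrite dvdn_gcd p119.
  by rewrite dvdn1 => /eqP p1; move: pp; rewrite p1.
have m2 : (2 * m = (2 * m).-1.+1)%N by rewrite prednK // muln_gt0.
have AB' := AB; rewrite m2 in AB'; have BA := AB'; rewrite mulnC in BA.
have [c hc] := coprime_mul_expn A0 B0 cop AB'; rewrite -m2 in hc.
have [d hd] : exists d, (B = d ^ (2 * m).-1.+1)%N.
  by apply: (coprime_mul_expn B0 A0 _ BA); rewrite coprime_sym.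
rewrite -m2 in hd.
have m20 : (0 < 2 * m)%N by rewrite muln_gt0.
have cd : (c * d = 119)%N.
  by apply/eqP; rewrite -(eqn_exp2r _ _ m20) expnMn -hc -hd AB.
have cltd : (c < d)%N by rewrite -(ltn_exp2r _ _ m20) -hc -hd EBA -addn1 leq_add2l muln_gt0 expn_gt0.
have c11 : (c < 11)%N by nia.
have : (c = 1 /\ d = 119 \/ c = 7 /\ d = 17)%N.
  case: c c11 cd {hc cltd} => [|[|[|[|[|[|[|[|[|[|[|c]]]]]]]]]]] // _; lia.
rewrite hc hd in EBA; case=> -[Ec Ed]; rewrite Ec Ed in EBA.
  by have := pow_119_gt m0; rewrite EBA exp1n ltnn.
have [m1|m1] := leqP m 1; first by lia.
by have := pow_289_gt m1; rewrite EBA ltnn.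
Qed.

Lemma expr_eq1_sign (y : int) n : (0 < n)%N -> y ^+ n = 1 -> y = 1 \/ ~~ odd n /\ y = -1.
Proof.
move=> n0 E; have /eqP : (absz y ^ n = 1)%N by rewrite -abszX E.
rewrite -(exp1n n) eqn_exp2r // => /eqP y1.
have [->|ym] : y = 1 \/ y = -1 by lia.
  by left.
right; split=> //; apply/negP => on; move: E.
by rewrite ym -signr_odd on.
Qed.

Lemma pow4_eq13 (y : int) : y ^+ 4 = 13 ^+ 4 -> y = 13 \/ y = -13.
Proof.
move=> E; have /eqP : (absz y ^ 4 = 13 ^ 4)%N by rewrite -abszX E abszX.
by rewrite eqn_exp2r // => /eqP; lia.
Qed.

Theorem theorem1p3 (k : nat) (k_gt0 : (0 < k)%N) (k_mod4 : k = 2 %[mod 4])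
  (k_primes : forall p : nat, prime p -> odd p -> (p %| k)%N -> p = 3 %[mod 4])
  (x y : int) (n : nat) (n_ge3 : (3 <= n)%N) :
  x ^+ k + (x + 1) ^+ k = y ^+ n <->
  exists y0 : int,
    (y = y0 \/ (~~ odd n /\ y = - y0)) /\
    ((x, y0) = (0, 1) \/ (x, y0) = (-1, 1) \/
     (k = 2%N /\ ((x, y0, n) = (119, 13, 4%N) \/ (x, y0, n) = (-120, 13, 4%N)))).
Proof.
have [m om Ek] : exists2 m, odd m & k = (2 * m)%N.
  exists k./2; have := odd_double_half k; have := divn_eq k 4; rewrite k_mod4 /=; lia.
have n0 : (0 < n)%N by lia.
have even_expr a : (- a) ^+ k = a ^+ k :> int by rewrite Ek !exprM sqrrN.
split=> [E|[y0 [hy hx]]]; last first.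
  have -> : y ^+ n = y0 ^+ n.
    by case: hy => [->//|[en ->]]; rewrite exprNn -signr_odd (negbTE en) mul1r.
  case: hx => [[-> ->]|[[-> ->]|[-> [[-> -> ->]|[-> -> ->]]]]].
  - by rewrite expr0n gtn_eqF // add0r !expr1n.
  - by rewrite even_expr addNr expr0n gtn_eqF // addr0 !expr1n.
  - by ring.
  - by ring.
have m_primes p : prime p -> (p %| m)%N -> (p %% 4 = 3)%N.
  move=> pp pm; have op : odd p by apply: dvdn_odd om.
  by apply: k_primes => //; rewrite Ek dvdn_mull.
have m0 : (0 < m)%N by case: m om {Ek m_primes}.
have E' := E; rewrite Ek in E'; have [z Ez] := sum_pow_reduction om n0 m_primes E'.
case: (consecutive_squares_power n_ge3 Ez) => [Ex|[Ex|[hx n4]]].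
- have /(expr_eq1_sign n0)[->|[en ->]] : y ^+ n = 1.
    by rewrite -E Ex expr0n gtn_eqF // !add0r expr1n.
    by exists 1; rewrite Ex; split; left.
  by exists 1; rewrite Ex; split; [right | left].
- have /(expr_eq1_sign n0)[->|[en ->]] : y ^+ n = 1.
    by rewrite -E Ex even_expr addNr expr0n gtn_eqF // addr0 expr1n.
    by exists 1; rewrite Ex; split; [left | right; left].
  by exists 1; rewrite Ex; split; [right | right; left].
(* Since [k] is even, both exceptional values of [x] lead to this one equation. *)
have E120 : 119 ^+ k + 120 ^+ k = y ^+ 4.
  transitivity (y ^+ n); [rewrite -E | by rewrite n4]; case: hx => hx.
    have -> : x + 1 = 120 by rewrite hx; ring.
    by rewrite hx.
  have -> : x + 1 = - 119 by rewrite hx; ring.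
  by rewrite hx !even_expr addrC.
have m1 : m = 1%N.
  apply: (@pow_119_120_quartic m (absz y)) => //; rewrite -Ek.
  have PoszX a b : (a ^ b)%N%:Z = a%:Z ^+ b by rewrite -[LHS]natz natrX natz.
  apply/eqP; rewrite -eqz_nat PoszD !PoszX abszE E120.
  by rewrite !(exprM _ 2 2) real_normK ?num_real.
have k2 : k = 2%N by rewrite Ek m1.
have /pow4_eq13 hy : y ^+ 4 = 13 ^+ 4 by rewrite -E120 k2; ring.
exists 13; split; first by case: hy => ->; [left | right; rewrite n4].
by right; right; split=> //; case: hx => ->; [left | right]; rewrite n4.
Qed.
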